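(* Let $X_{\mathrm{pd}}$ denote the period doubling subshift, let $\kappa,\ell\ge2$ be integers, and let $X=\eta_{\kappa,\ell}^{-1}(X_{\mathrm{pd}})\subseteq\mathcal A_\kappa^{\mathbb Z}$ (with the left shift). Then $X$ is strictly ergodic if $\ell$ is even, and also if $\ell=3$ and $\kappa$ is odd. In all other cases, $X$ is non-minimal.
   Context: $\mathbb N=\{1,2,\dots\}$, $\mathcal A_\kappa=\{0,\dots,\kappa-1\}$; $\mathcal A_\kappa^{\mathbb Z}$ carries the product topology and $\sigma(x)_n=x_{n+1}$ is the left shift. The period doubling substitution is $\Gamma_{\mathrm{pd}}:1\mapsto10,\ 0\mapsto11$ (extended to words by concatenation). $X_{\mathrm{pd}}$ is the set of all $x\in\{0,1\}^{\mathbb Z}$ such that every finite word occurring in $x$ is a subword of $\Gamma_{\mathrm{pd}}^n(1)$ for some $n\in\mathbb N$; since $\{0,1\}\subseteq\mathcal A_\kappa$ it is regarded as a subshift of $\mathcal A_\kappa^{\mathbb Z}$. For $\kappa,\ell\ge2$, $\eta_{\kappa,\ell}:\mathcal A_\kappa^{\mathbb Z}\to\mathcal A_\kappa^{\mathbb Z}$ is the sliding block code $\eta_{\kappa,\ell}(x)_n=x_{n+\ell-1}-x_n\bmod\kappa$. A system is minimal if all its orbits are dense, and strictly ergodic if it is minimal and has exactly one shift-invariant Borel probability measure. *)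

(* Defs.v *)
From HB Require Import structures.
From mathcomp Require Import all_boot all_order all_algebra.
From mathcomp Require Import all_classical all_reals all_analysis.

Set Implicit Arguments.
Unset Strict Implicit.
Unset Printing Implicit Defensive.

Import Order.TTheory GRing.Theory Num.Theory.

Local Open Scope classical_set_scope.
Local Open Scope ring_scope.

HB.instance Definition _ (n : nat) := isPointed.Build 'I_n.+1 ord0.

(* The alphabet {0, ..., k-1} is 'Z_k, so that subtraction of letters is
   subtraction mod k; this requires 1 < k, since 'Z_0 and 'Z_1 have two
   elements. *)
Definition full_shift (k : nat) : Type :=
  prod_topology (fun _ : int => discrete_topology 'Z_k).

HB.instance Definition _ (k : nat) := Topological.on (full_shift k).
HB.instance Definition _ (k : nat) :=
  Pointed.copy (full_shift k) (int -> 'Z_k).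

(* shiftz m is the m-th iterate (m : int) of the left shift sigma = shiftz 1. *)
Definition shiftz (A : Type) (m : int) (x : int -> A) : int -> A :=
  fun n => x (n + m).

Definition shift_orbit (k : nat) (x : full_shift k) : set (full_shift k) :=
  [set (shiftz m x : full_shift k) | m in [set: int]].

(* For x in a shift-invariant set X, the orbit of x is dense in the subspace X
   iff X is contained in its closure in the full shift. *)
Definition minimal (k : nat) (X : set (full_shift k)) : Prop :=
  forall x, X x -> X `<=` closure (shift_orbit x).

Definition borel_shift (k : nat) := g_sigma_algebraType (@open (full_shift k)).

(* Shift-invariant Borel probability measures on X are seen as those measures
   on the full shift that give mass 1 to X. *)
Definition invariant_probability_on (k : nat) (R : realType)
    (X : set (full_shift k)) (mu : probability (borel_shift k) R) : Prop :=
  mu X = 1%E /\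
  forall A : set (borel_shift k), measurable A -> mu (shiftz 1 @^-1` A) = mu A.

(* Elements of probability T R are functions on all of set T; measures are
   compared on measurable sets only. *)
Definition uniquely_ergodic (k : nat) (R : realType)
    (X : set (full_shift k)) : Prop :=
  exists2 mu : probability (borel_shift k) R,
    invariant_probability_on X mu &
    forall nu : probability (borel_shift k) R,
      invariant_probability_on X nu ->
      forall A : set (borel_shift k), measurable A -> nu A = mu A.

Definition strictly_ergodic (k : nat) (R : realType)
    (X : set (full_shift k)) : Prop :=
  minimal X /\ uniquely_ergodic R X.

(* Letters 1 and 0 are true and false: 1 |-> 10, 0 |-> 11. *)
Definition pd_subst (w : seq bool) : seq bool :=
  flatten [seq (if a then [:: true; false] else [:: true; true]) | a <- w].

Definition subword_at (A : Type) (x : int -> A) (a : int) (len : nat) : seq A :=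
  [seq x (a + i%:Z) | i <- iota 0 len].

Definition period_doubling : set (int -> bool) :=
  [set x | forall (a : int) (len : nat), exists2 n : nat, (0 < n)%N &
     infix (subword_at x a len) (iter n pd_subst [:: true])].

Definition X_pd (k : nat) : set (full_shift k) :=
  [set ((fun n => (nat_of_bool (x n))%:R) : full_shift k)
  | x in period_doubling].

Arguments X_pd : clear implicits.

Definition eta_code (k l : nat) (x : full_shift k) : full_shift k :=
  fun n => (x (n + l%:Z - 1) : 'Z_k) - (x n : 'Z_k).

Arguments eta_code : clear implicits.

(* Main.v *)
Require Import Defs.
From HB Require Import structures.
From mathcomp Require Import all_boot all_order all_algebra.
From mathcomp Require Import all_classical all_reals all_analysis.
From mathcomp Require Import measurable_realfun perm zify ring lra.

(** Write [M.+1 = l - 1]. A point [x] of [X] solves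
    [x (n + M.+1) = x n + y n] over a period doubling sequence [y]. Thus [x] is
    given by [y] and by one window of [M.+1] letters, its state, and reading a
    word of [y] changes the state by [act]. For every [n], the sequence [y] is
    cut into blocks [pd_block n c], which have length [2 ^ n] and depend on [c]
    in their last letter only. So the two transitions of level [n] differ by a
    translation along the last coordinate.

    Strict ergodicity. The transitions of every level [n >= 1] act transitively
    on states, in the form [mixing]: a function of the state invariant under both
    of them is constant. If [l] is even, conjugating the translation above by a
    transition rotates it by [2 ^ n] coordinates, and [2 ^ n] is prime to [M.+1],
    so translations along all coordinates are obtained ([mixing_odd]). If [l = 3]
    and [k] is odd, the transitions are translations, one coordinate of which is
    [2 ^ (n - 1)], a unit mod [k] ([mixing_two]). Now let [reach n s b] be the set
    of states met at cuts of level [n] inside a block of level [n + s] entered in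
    state [b]. It grows with [s], and cannot always grow, so for some [s] bounded
    independently of [n] it is stable; it is then an invariant function of [b],
    hence the set of all states ([reach_full]). Therefore every pattern of two
    blocks of level [n], with every state, occurs in every block of level
    [n + recurrence_time] ([block_recurrence]). This linear recurrence gives
    minimality ([extension_visits]), and it makes the oscillation of the number of
    visits to a clopen set contract by a fixed factor relative to the length of
    blocks ([block_osc_contract]). So visit frequencies converge uniformly, which
    yields existence and uniqueness of the invariant measure
    ([uniform_freq_uniquely_ergodic]).

    Non-minimality. If [l] is odd, then [M.+1] is even, and [y] is constant 1 on
    one class of positions mod 2, so on that class [x] increases by 1 at each step
    of length [M.+1], whatever the other letters of [y] are. The zeros of [y] show
    the residue mod 4 of a position, so two lifts of the same [y] can be close only
    along shifts by multiples of 4. In the cases left, an initial window of zeros and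
    another well chosen initial window are never matched by such a shift. *)

Import numFieldNormedType.Exports.

Set Implicit Arguments.
Unset Strict Implicit.
Unset Printing Implicit Defensive.

Import Order.TTheory GRing.Theory Num.Theory.

Local Open Scope classical_set_scope.
Local Open Scope ring_scope.

(** * The substitution on two-sided sequences *)

Definition pd_subst2 (z : int -> bool) : int -> bool :=
  fun n => if (n %% 2)%Z == 0 then true else ~~ z (n %/ 2)%Z.

Lemma pd_subst2_even z i : pd_subst2 z (2 * i) = true.
Proof. by rewrite /pd_subst2; case: eqP => // h; exfalso; lia. Qed.

Lemma pd_subst2_odd z i : pd_subst2 z (2 * i + 1) = ~~ z i.
Proof.
rewrite /pd_subst2; case: eqP => h; first by exfalso; lia.
by congr (~~ z _); lia.
Qed.

Lemma shiftz_pd_subst2 t z :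
  shiftz (2 * t) (pd_subst2 z) = pd_subst2 (shiftz t z).
Proof.
apply/funext => n; rewrite /shiftz.
have -> : n = if (n %% 2)%Z == 0 then 2 * (n %/ 2)%Z else 2 * (n %/ 2)%Z + 1.
  by case: eqP => h; lia.
case: ifP => _; first by rewrite -mulrDr !pd_subst2_even.
by rewrite addrAC -mulrDr !pd_subst2_odd.
Qed.

Lemma shiftz_iter_pd_subst2 n t z :
  shiftz ((2 ^ n)%:Z * t) (iter n pd_subst2 z)
  = iter n pd_subst2 (shiftz t z).
Proof.
elim: n t => [|n IHn] t; first by rewrite expn0 mul1r.
have -> : (2 ^ n.+1)%:Z * t = 2 * ((2 ^ n)%:Z * t) by rewrite expnS; lia.
by rewrite !iterS -IHn -shiftz_pd_subst2.
Qed.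

(** This property restricts which two blocks may follow each other. *)
Definition no_two_zeros (z : int -> bool) := forall i, z i || z (i + 1).

Lemma no_two_zeros_pd_subst2 z : no_two_zeros (pd_subst2 z).
Proof. by move=> i; rewrite /pd_subst2; case: eqP => //; case: eqP => //; lia. Qed.

Lemma no_two_zeros_shiftz t z : no_two_zeros z -> no_two_zeros (shiftz t z).
Proof. by move=> h i; have := h (i + t); rewrite /shiftz addrAC. Qed.

Definition pd_block (n : nat) (c : bool) : seq bool := iter n pd_subst [:: c].

Lemma pd_subst_cat u v : pd_subst (u ++ v) = pd_subst u ++ pd_subst v.
Proof. by rewrite /pd_subst map_cat flatten_cat. Qed.

Lemma iter_pd_subst_cat n u v :
  iter n pd_subst (u ++ v) = iter n pd_subst u ++ iter n pd_subst v.
Proof. by elim: n u v => [//|n IHn] u v; rewrite !iterS IHn pd_subst_cat. Qed.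

Lemma pd_blockS n c : pd_block n.+1 c = pd_block n true ++ pd_block n (~~ c).
Proof. by rewrite /pd_block iterSr -iter_pd_subst_cat; case: c. Qed.

Lemma size_pd_block n c : size (pd_block n c) = (2 ^ n)%N.
Proof.
elim: n c => [//|n IHn] c.
by rewrite pd_blockS size_cat !IHn expnS mul2n addnn.
Qed.

(** The images of the two letters agree but in the last place, and the
    substitution exchanges 0 and 1 there; hence the parity of [n]. *)
Lemma pd_block_rcons n :
  exists u, forall c, pd_block n c = rcons u (c (+) odd n).
Proof.
elim: n => [|n [u hu]]; first by exists [::] => c; rewrite addbF.
exists (pd_block n true ++ u) => c.
rewrite pd_blockS (hu (~~ c)) rcons_cat /=; by case: c; case: (odd n).
Qed.

Lemma subword_at_cat (A : Type) (x : int -> A) a m n :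
  subword_at x a (m + n) = subword_at x a m ++ subword_at x (a + m%:Z) n.
Proof.
rewrite /subword_at iotaD map_cat add0n; congr (_ ++ _).
rewrite -[in iota m n](addn0 m) iotaDl -map_comp; apply: eq_map => i /=.
by congr x; lia.
Qed.

Lemma size_subword_at (A : Type) (x : int -> A) a n : size (subword_at x a n) = n.
Proof. by rewrite size_map size_iota. Qed.

Lemma nth_subword_at (A : Type) (d : A) (x : int -> A) a n i : (i < n)%N ->
  nth d (subword_at x a n) i = x (a + i%:Z).
Proof. by move=> hi; rewrite (nth_map 0%N) ?size_iota // nth_iota. Qed.

Lemma subword_at_shiftz (A : Type) (x : int -> A) m a n :
  subword_at (shiftz m x) a n = subword_at x (a + m) n.
Proof. by apply: eq_map => i; rewrite /shiftz addrAC. Qed.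

Lemma subword_at_block n z i :
  subword_at (iter n pd_subst2 z) ((2 ^ n)%:Z * i) (2 ^ n) = pd_block n (z i).
Proof.
elim: n z i => [|n IHn] z i.
  by rewrite expn0 mul1r /subword_at /= addr0.
rewrite iterSr {2}expnS mul2n -addnn subword_at_cat pd_blockS.
have -> : (2 ^ n.+1)%:Z * i = (2 ^ n)%:Z * (2 * i) by rewrite expnS; lia.
have -> : (2 ^ n)%:Z * (2 * i) + (2 ^ n)%:Z = (2 ^ n)%:Z * (2 * i + 1) by lia.
by rewrite !IHn pd_subst2_even pd_subst2_odd.
Qed.

Lemma subword_at_iter n z i len :
  subword_at (iter n pd_subst2 z) ((2 ^ n)%:Z * i) (2 ^ n * len)
  = iter n pd_subst (subword_at z i len).
Proof.
elim: len i => [|len IH] i; first by rewrite muln0; elim: n => //= n <-.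
rewrite mulnS subword_at_cat subword_at_block -[len.+1 in RHS]add1n.
rewrite subword_at_cat iter_pd_subst_cat {2}/subword_at /= addr0 -IH.
by congr (_ ++ subword_at _ _ _); lia.
Qed.

Lemma subword_at_iter0 n z len :
  subword_at (iter n pd_subst2 z) 0 (2 ^ n * len)
  = iter n pd_subst (subword_at z 0 len).
Proof. by have := subword_at_iter n z 0 len; rewrite mulr0. Qed.

(** * Period doubling words and desubstitution *)

(** The one-sided fixed point of the substitution, with positions counted from
    1; at 0 the convention [logn 2 0 = 0] gives the letter 1. *)
Definition toeplitz (m : nat) : bool := ~~ odd (logn 2 m).

Lemma toeplitz_odd m : odd m -> toeplitz m.
Proof. by move=> om; rewrite /toeplitz lognE dvdn2 om andbF. Qed.

Lemma toeplitz_double m : (0 < m)%N -> toeplitz m.*2 = ~~ toeplitz m.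
Proof. by move=> m0; rewrite /toeplitz -mul2n lognM // /= oddD. Qed.

Lemma toeplitz_addr n m : (0 < m < 2 ^ n)%N -> toeplitz (2 ^ n + m) = toeplitz m.
Proof.
elim: n m => [|n IHn] m; first by case: m => [|[]].
move=> /andP[m0 mn]; have [om|em] := boolP (odd m).
  by rewrite !toeplitz_odd // oddD oddX om.
have em' : m = m./2.*2 by rewrite even_halfK.
rewrite em' expnS mul2n -doubleD !toeplitz_double ?IHn //; last first.
- by rewrite addn_gt0 expn_gt0.
- by rewrite em' double_gt0 in m0.
- by rewrite em' double_gt0 in m0; rewrite m0 /=; move: mn; rewrite expnS; lia.
Qed.

Lemma pd_block_toeplitz n c i : (i < 2 ^ n)%N ->
  nth true (pd_block n c) i
  = if i.+1 == (2 ^ n)%N then c (+) odd n else toeplitz i.+1.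
Proof.
elim: n c i => [|n IHn] c i; first by case: i => // _; rewrite /= addbF.
move=> hi; rewrite pd_blockS nth_cat size_pd_block.
case: ltnP => hin.
  rewrite IHn //.
  have -> : (i.+1 == 2 ^ n.+1)%N = false by apply/negbTE; rewrite expnS; lia.
  case: eqP => // ->; rewrite /toeplitz pfactorK //.
have hi2 : (i - 2 ^ n < 2 ^ n)%N by move: hi; rewrite expnS; lia.
rewrite IHn //; have -> : ((i - 2 ^ n).+1 == 2 ^ n)%N = (i.+1 == 2 ^ n.+1)%N.
  by rewrite expnS; lia.
case: eqP => h; first by rewrite /=; case: c; case: (odd n).
rewrite -(@toeplitz_addr n); first by congr toeplitz; lia.
by move: h; rewrite expnS; lia.
Qed.

Lemma pd_block_true n i : (i < 2 ^ n)%N ->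
  nth true (pd_block n true) i = toeplitz i.+1.
Proof.
move=> hi; rewrite pd_block_toeplitz //; case: eqP => // ->.
by rewrite /toeplitz pfactorK // addTb.
Qed.

Lemma infix_toeplitz (y : int -> bool) a len n :
  infix (subword_at y a len) (pd_block n true) ->
  exists2 s : nat, (0 < s)%N &
    forall i, (i < len)%N -> y (a + i%:Z) = toeplitz (s + i).
Proof.
case/infixP=> p [q e]; exists (size p).+1 => // i hi.
have hs := congr1 size e.
rewrite !size_cat size_pd_block size_subword_at in hs.
rewrite -(@nth_subword_at _ true y a len i hi) addSn -(@pd_block_true n); last by lia.
rewrite e nth_cat ltnNge leq_addr /= addKn nth_cat size_subword_at hi //.
Qed.

Lemma toeplitz_infix (y : int -> bool) a len s : (0 < s)%N ->
  (forall i, (i < len)%N -> y (a + i%:Z) = toeplitz (s + i)) ->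
  exists2 n : nat, (0 < n)%N &
    infix (subword_at y a len) (pd_block n true).
Proof.
move=> s0 h; exists (s + len).+1 => //.
apply/infixP.
set n := (s + len).+1.
have hn : (s + len < 2 ^ n)%N by apply: (ltn_trans (ltnSn _)); apply: ltn_expl.
exists (take s.-1 (pd_block n true)), (drop (s.-1 + len) (pd_block n true)).
rewrite -[LHS](cat_take_drop s.-1); congr (_ ++ _).
rewrite -[LHS](cat_take_drop len) drop_drop addnC; congr (_ ++ _).
apply: (@eq_from_nth _ true) => [|i].
  by rewrite size_subword_at size_take size_drop size_pd_block; case: ltnP => hl; lia.
rewrite size_take size_drop size_pd_block => hi.
have {}hi : (i < len)%N by move: hi; case: (ltnP len) => ? ?; lia.
rewrite nth_take // nth_drop nth_subword_at // pd_block_true; last by lia.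
by rewrite h //; congr toeplitz; lia.
Qed.

(** Factors of the substitution words are the factors of their limit, which turns
    membership into arithmetic of 2-adic valuations. *)
Lemma period_doublingP (y : int -> bool) : period_doubling y <->
  forall a len, exists2 s : nat, (0 < s)%N &
    forall i, (i < len)%N -> y (a + i%:Z) = toeplitz (s + i).
Proof.
split=> h a len; have := h a len.
  by case=> n _; apply: infix_toeplitz.
by case=> s s0 hs; apply: toeplitz_infix s0 hs.
Qed.

Lemma period_doubling_no_two_zeros y : period_doubling y -> no_two_zeros y.
Proof.
move=> /period_doublingP h i; have [s s0 hs] := h i 2%N.
have := hs 0%N; rewrite addr0 => -> //; have -> := hs 1%N => //.
have [os|es] := boolP (odd s); first by rewrite toeplitz_odd ?addn0.
by apply/orP; right; apply: toeplitz_odd; rewrite addn1 /= es.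
Qed.

Lemma period_doubling_shiftz t y :
  period_doubling y -> period_doubling (shiftz t y).
Proof. by move=> h a len; rewrite subword_at_shiftz; apply: h. Qed.

(** In the fixed point a 0 stands at even positions only. A period doubling
    sequence contains a 0, so all its windows that contain this 0 are cut in the
    same way, and the complements of the second letters of the pairs form a
    desubstitution. *)
Lemma pd_desubst y : period_doubling y ->
  exists t : nat, exists z : int -> bool,
    [/\ (t < 2)%N, period_doubling z & shiftz t%:Z y = pd_subst2 z].
Proof.
move=> /period_doublingP h.
(* Four consecutive positions include one that is 2 mod 4, where the fixed
   point is 0. *)
have [p yp] : exists p : int, y p = false.
  have [s s0 hs] := h 0 4%N.
  suff [i hi ti] : exists2 i, (i < 4)%N & toeplitz (s + i) = false.
    by exists i%:Z; rewrite -ti -hs // add0r.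
  exists ((6 - s %% 4) %% 4)%N; first by rewrite ltn_mod.
  set m := (s + _)%N.
  have [q ->] : exists q, m = q.*2.+1.*2.
    by exists (m %/ 4)%N; rewrite /m; lia.
  by rewrite toeplitz_double // toeplitz_odd //= odd_double.
pose t : nat := `|((p + 1) %% 2)%Z|%N.
(* The position of a 0 in a long window determines the parity of the cut. *)
have win b len : exists2 s : nat, odd s &
    forall i, (i < len)%N -> y (2 * b + t%:Z + i%:Z) = toeplitz (s + i).
  pose a0 := Order.min (2 * b + t%:Z) p.
  pose b0 := Order.max (2 * b + t%:Z + len%:Z) (p + 1).
  have [s s0 hs] := h a0 `|b0 - a0|%N.
  have hp : toeplitz (s + `|p - a0|)%N = false.
    by rewrite -hs; [rewrite -yp; congr y | ]; rewrite /b0 /a0; lia.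
  have op : ~~ odd (s + `|p - a0|)%N.
    by apply/negP => /toeplitz_odd; rewrite hp.
  exists (s + `|(2 * b + t%:Z - a0)%R|)%N; first by move: op; rewrite /t /a0; lia.
  move=> i hi; rewrite -addnA -hs; first by congr y; rewrite /a0; lia.
  by rewrite /b0 /a0; lia.
exists t, (fun i => ~~ y (2 * i + 1 + t%:Z)); split.
- by rewrite /t; lia.
- apply/period_doublingP => a len; have [s os hs] := win a (len.*2).
  exists (s.+1./2)%N; first by lia.
  move=> i hi; have -> : 2 * (a + i%:Z) + 1 + t%:Z = 2 * a + t%:Z + (i.*2.+1)%:Z by lia.
  rewrite hs; last by lia.
  have -> : (s + i.*2.+1 = (s.+1./2 + i).*2)%N by lia.
  by rewrite toeplitz_double ?negbK //; lia.
- apply/funext => n; rewrite /pd_subst2 /shiftz; case: eqP => hn.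
    have [s os hs] := win (n %/ 2)%Z 1%N.
    have -> : n + t%:Z = 2 * (n %/ 2)%Z + t%:Z + 0%:Z by lia.
    by rewrite hs // addn0 toeplitz_odd.
  by rewrite negbK; congr y; lia.
Qed.

Lemma pd_desubst_iter n y : period_doubling y ->
  exists t : nat, exists z : int -> bool,
    [/\ (t < 2 ^ n)%N, period_doubling z & shiftz t%:Z y = iter n pd_subst2 z].
Proof.
elim: n y => [|n IHn] y hy.
  by exists 0%N, y; split=> //; apply/funext => i; rewrite /shiftz addr0.
have [t [z [ht hz yz]]] := IHn y hy.
have [u [w [hu hw zw]]] := pd_desubst hz.
exists (2 ^ n * u + t)%N, w; split=> //.
  by rewrite expnS; nia.
rewrite iterSr -zw -shiftz_iter_pd_subst2 -yz.
by apply/funext => i; rewrite /shiftz; congr y; lia.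
Qed.

(** * States and their transitions *)

Section States.
Variables (k M : nat).

Definition state := {ffun 'I_M.+1 -> 'Z_k}.

Definition rotate_state (s : state) : state := [ffun j => s (ordS j)].

Definition last_unit : state := [ffun j => (j == ord_max)%:R].

(** The window slides by one place, and the entry coming in at its end is the
    entry leaving at its front plus the letter read. *)
Definition step (s : state) (c : bool) : state := rotate_state s + last_unit *+ c.

Definition act (w : seq bool) (s : state) : state := foldl step s w.

Lemma act_cons c w s : act (c :: w) s = act w (step s c).
Proof. by []. Qed.

Lemma act_cat u v s : act (u ++ v) s = act v (act u s).
Proof. exact: foldl_cat. Qed.

Lemma rotD s t : rotate_state (s + t) = rotate_state s + rotate_state t.
Proof. by apply/ffunP => j; rewrite !ffunE. Qed.

Lemma rot_inj : injective rotate_state.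
Proof.
move=> s t /ffunP e; apply/ffunP => j.
by have := e (ord_pred j); rewrite !ffunE ord_predK.
Qed.

(** Transitions are affine: translations of the state are carried along by
    rotation only. *)
Lemma actD w s t : act w (s + t) = act w s + iter (size w) rotate_state t.
Proof.
elim: w s t => [//|c w IHw] s t.
by rewrite [size _]/= iterSr !act_cons -IHw /step rotD addrAC.
Qed.

Lemma act_inj w : injective (act w).
Proof.
elim: w => [//|c w IHw] s t /IHw; rewrite /step => /addIr; exact: rot_inj.
Qed.

Lemma act_surj w t : exists s, act w s = t.
Proof.
have /injF_bij [g _ gK] : injective (act w) by apply: act_inj.
by exists (g t).
Qed.

Lemma iter_rotE n s (j : 'I_M.+1) : iter n rotate_state s j = s (inord ((j + n) %% M.+1)).
Proof.
elim: n j => [|n IHn] j; first by rewrite addn0 modn_small //= inord_val.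
rewrite iterS ffunE IHn; congr (s _); apply: val_inj.
rewrite /= !inordK ?ltn_mod //= modnDml; congr (_ %% _)%N; lia.
Qed.

Lemma iter_rot_mod m n s : m = n %[mod M.+1] -> iter m rotate_state s = iter n rotate_state s.
Proof.
move=> e; apply/ffunP => j; rewrite !iter_rotE; congr (s _); congr inord.
by rewrite -modnDmr e modnDmr.
Qed.

Lemma state_decomp (s : state) :
  s = \sum_(j < M.+1) (iter (M - j)%N rotate_state last_unit) *+ (s j : nat).
Proof.
apply/ffunP => i; rewrite sum_ffunE.
have e (j : 'I_M.+1) : (iter (M - j)%N rotate_state last_unit *+ s j) i
    = (if i == j then s i else 0).
  rewrite ffunMnE iter_rotE ffunE; case: (i =P j) => [->|ne].
    have -> : inord ((j + (M - j)) %% M.+1) = ord_max :> 'I_M.+1.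
      apply: val_inj; rewrite /= inordK ?ltn_mod // subnKC ?modn_small //.
      by rewrite -ltnS.
    by rewrite eqxx natr_Zp.
  have -> : (inord ((i + (M - j)) %% M.+1) == ord_max :> 'I_M.+1) = false.
    apply/negbTE/eqP => /(congr1 val) /=; rewrite inordK ?ltn_mod // => h.
    apply: ne; apply: val_inj => /=; have := ltn_ord i; have := ltn_ord j.
    rewrite !ltnS => hj hi.
    case: (ltnP (i + (M - j)) M.+1) => hij; first by rewrite modn_small in h; lia.
    have e2 : (i + (M - j) = (i - j).-1 + M.+1)%N by lia.
    by rewrite e2 modnDr modn_small in h; lia.
  by rewrite mul0rn.
by rewrite (eq_bigr _ (fun j _ => e j)) -big_mkcond (big_pred1 i) // => j; rewrite eq_sym.
Qed.

(** * Transitivity of the transitions at every level *)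

(** Transitivity of the group generated by the two transitions of level [n],
    phrased without the group: invariant functions are constant. *)
Definition mixing (n : nat) := forall (T : Type) (f : state -> T),
  (forall c s, f (act (pd_block n c) s) = f s) -> forall s t, f s = f t.

Section Invariants.
Variables (T : Type) (f : state -> T) (n : nat).
Hypothesis fA : forall c s, f (act (pd_block n c) s) = f s.

(** The two blocks of level [n] share all letters but the last, so from a common
    state they lead to two states that differ by [last_unit]. *)
Lemma invariant_last_unit s : f (s + last_unit) = f s.
Proof.
have [u hu] := pd_block_rcons n.
have [b hb] : exists b, act (rcons u false) b = s by apply: act_surj.
have hb1 : act (rcons u true) b = s + last_unit.
  move: hb; rewrite -!cats1 !act_cat /= /step => <-.
  by rewrite mulr0n addr0 mulr1n.
have e c : f (act (rcons u c) b) = f b.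
  by rewrite -(fA (c (+) odd n) b) hu -addbA addbb addbF.
by rewrite -hb1 -hb !e.
Qed.

Lemma invariant_rot t : (forall s, f (s + t) = f s) ->
  forall s, f (s + iter (2 ^ n)%N rotate_state t) = f s.
Proof.
move=> ft s; have [b <-] := act_surj (pd_block n true) s.
by rewrite -(size_pd_block n true) -actD !fA.
Qed.

Lemma invariant_iter_rot i s :
  f (s + iter (i * 2 ^ n)%N rotate_state last_unit) = f s.
Proof.
elim: i s => [|i IHi] s; first exact: invariant_last_unit.
by rewrite mulSn iterD; apply: invariant_rot.
Qed.

Lemma invariant_const :
  (forall j : 'I_M.+1, forall s, f (s + iter (M - j)%N rotate_state last_unit) = f s) ->
  forall s t, f s = f t.
Proof.
move=> h s t; suff H u v : f (v + u) = f v by rewrite -(H (t - s)) addrC subrK.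
rewrite (state_decomp u).
elim/big_rec: _ v => [|j w _ IHw] v; first by rewrite addr0.
rewrite addrA IHw.
elim: (u j : nat) => [|m IHm]; first by rewrite addr0.
by rewrite mulrSr addrA h.
Qed.

End Invariants.

(** Powers of 2 are invertible modulo the odd width, so iterating the rotation by
    [2 ^ n] places carries the last coordinate to any other one. *)
Lemma mixing_odd n : odd M.+1 -> mixing n.
Proof.
move=> oM T f fA; apply: invariant_const => j s.
have cop : coprime (2 ^ n) M.+1 by rewrite coprimeXl // coprime2n.
have [i hi] : exists i, (i * 2 ^ n = M - j %[mod M.+1])%N.
  have := egcdnP M.+1 (expn_gt0 2 n); case=> a b e _.
  exists (a * (M - j))%N.
  have -> : (a * (M - j) * 2 ^ n = (a * 2 ^ n) * (M - j))%N by lia.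
  move: cop; rewrite /coprime => /eqP g; rewrite e g mulnDl mul1n.
  have -> : (b * M.+1 * (M - j) = (b * (M - j)) * M.+1)%N by lia.
  by rewrite modnMDl.
by rewrite -(iter_rot_mod _ hi); apply: invariant_iter_rot fA i s.
Qed.

End States.

(** The first letter of the image of each letter is 1, and with two coordinates
    these first letters are the ones added to coordinate 0. *)
Lemma act_pd_subst_ord0 k w (s : state k 1) :
  act (pd_subst w) s ord0 = s ord0 + (size w)%:R.
Proof.
elim: w s => [|c w IHw] s; first by rewrite addr0.
have -> : pd_subst (c :: w) = [:: true; ~~ c] ++ pd_subst w by case: c.
rewrite act_cat IHw [size (c :: w)]/= -(add1n (size w)) natrD addrA; congr (_ + _).
have e01 : ordS (ord0 : 'I_2) = ord_max by apply: val_inj.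
have e10 : ordS (ord_max : 'I_2) = ord0 by apply: val_inj.
rewrite !act_cons /step !(ffunE, ffunMnE, e01, e10) eqxx.
by rewrite mul0rn addr0.
Qed.

(** For width 2 and [n >= 1] blocks have even length, so transitions are
    translations. Reading the block of 0 adds [2 ^ (n - 1)] to coordinate 0, a unit for
    odd [k], and the other coordinate is corrected by [last_unit]. *)
Lemma mixing_two k n : (1 < k)%N -> odd k -> (0 < n)%N -> @mixing k 1 n.
Proof.
case: n => // n k1 ok _ T f fA.
pose v := act (pd_block n.+1 false) (0 : state k 1).
have rot2 s : iter (2 ^ n.+1)%N (@rotate_state k 1) s = s.
  by rewrite (@iter_rot_mod _ _ _ 0) // expnS mul2n mod0n modn2 odd_double.
have fv m s : f (s + v *+ m) = f s.
  elim: m => [|m IHm]; first by rewrite addr0.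
  rewrite mulrSr addrA -{}IHm -[in RHS](fA false).
  by rewrite -[s + v *+ m in RHS]add0r actD size_pd_block rot2 addrC.
have fe m s : f (s + last_unit k 1 *+ m) = f s.
  elim: m => [|m IHm]; first by rewrite addr0.
  by rewrite mulrSr addrA (invariant_last_unit fA).
apply: (invariant_const) => j s.
case: (unliftP ord_max j) => [j' ->|->]; last first.
  by rewrite subnn; apply: (invariant_last_unit fA).
have -> : (1 - lift ord_max j' = 1)%N by case: j' => -[].
have u2 : (2 ^ n)%:R \is a @GRing.unit 'Z_k.
  by rewrite unitZpE // coprimeXr // coprimen2.
pose m : nat := ((2 ^ n)%:R^-1 : 'Z_k).
have mE : m%:R = (2 ^ n)%:R^-1 :> 'Z_k by rewrite /m natr_Zp.
have v0 : (v *+ m) ord0 = 1.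
  rewrite ffunMnE /v /pd_block iterS act_pd_subst_ord0 -/(pd_block n false).
  by rewrite size_pd_block ffunE add0r -[_ *+ m]mulr_natr mE divrr.
pose c : nat := (- (v *+ m) ord_max : 'Z_k).
have cE : c%:R = - (v *+ m) ord_max :> 'Z_k by rewrite /c natr_Zp.
have -> : iter 1 (@rotate_state k 1) (last_unit k 1) = v *+ m + last_unit k 1 *+ c.
  apply/ffunP => i; rewrite iter_rotE [RHS]ffunE (ffunMnE (last_unit k 1)).
  case: (unliftP ord_max i) => [i' ->|->].
    have -> : lift ord_max i' = ord0 by apply: val_inj; case: i' => -[].
    have -> : inord (((ord0 : 'I_2) + 1) %% 2)%N = ord_max :> 'I_2.
      by apply: val_inj; rewrite /= inordK.
    by rewrite v0 !ffunE eqxx mul0rn addr0.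
  have -> : inord (((ord_max : 'I_2) + 1) %% 2)%N = ord0 :> 'I_2.
    by apply: val_inj; rewrite /= inordK.
  by rewrite !(ffunE (fun j : 'I_2 => (j == ord_max)%:R)) eqxx cE subrr.
by rewrite addrA fe fv.
Qed.

(** * Reachable states *)

Section Reach.
Variables (k M : nat).
Local Notation state := (state k M).
Local Open Scope nat_scope.

(** States at the cuts of level [n] of a block of level [n + s] entered in state
    [b]. Both blocks of level [n + s'.+1] begin with the block of 1 of level
    [n + s'], so they give the same set. *)
Fixpoint reach (n s : nat) (b : state) : {set state} :=
  if s is s'.+1 then reach n s' b :|: reach n s' (act (pd_block (n + s') true) b)
  else [set b].

Lemma mem_reach n s b : b \in reach n s b.
Proof. by elim: s => [|s IHs] /=; rewrite inE ?eqxx // IHs. Qed.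

Lemma reach_sub n s b : reach n s b \subset reach n s.+1 b.
Proof. exact: finset.subsetUl. Qed.

Lemma reach_sub_act n s b :
  reach n s (act (pd_block (n + s) true) b) \subset reach n s.+1 b.
Proof. exact: finset.subsetUr. Qed.

Lemma reach_sub_act2 n s b :
  reach n s (act (pd_block (n + s) false) (act (pd_block (n + s) true) b))
  \subset reach n s.+2 b.
Proof.
rewrite -act_cat -(pd_blockS _ true) -addnS.
by apply: fintype.subset_trans (reach_sub _ _ _) (reach_sub_act _ _ _).
Qed.

Lemma subset_sum_eq (f g : state -> {set state}) : (forall b, f b \subset g b) ->
  \sum_b #|g b| <= \sum_b #|f b| -> forall b, f b = g b.
Proof.
move=> fg le b; apply/eqP; rewrite eqEcard fg /= leqNgt; apply/negP => lt.
move: le; rewrite leqNgt => /negP; apply.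
rewrite (bigD1 b) //= [X in _ < X](bigD1 b) //= -addSn leq_add //.
by apply: leq_sum => a _; apply: subset_leq_card.
Qed.

(** A finite total size cannot drop along a permutation. *)
Lemma subset_inj_eq (f : state -> {set state}) h : injective h ->
  (forall b, f (h b) \subset f b) -> forall b, f (h b) = f b.
Proof.
move=> hI fh; apply: (@subset_sum_eq (fun b => f (h b)) f fh).
by rewrite [leqLHS](reindex_inj hI).
Qed.

(** Two further levels add, among others, the sets reachable from the states
    obtained by the transition of 1, and by those of 1 and then 0. If they bring
    nothing new, [reach n s] is invariant under both transitions of level [n + s],
    so it is constant, and it always contains its argument. *)
Lemma reach_stable n s : mixing k M (n + s) ->
  \sum_b #|reach n s.+2 b| <= \sum_b #|reach n s b| ->
  forall b a, a \in reach n s b.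
Proof.
move=> mix le.
have e2 b : reach n s.+2 b = reach n s b.
  apply/esym; apply: subset_sum_eq le b => b.
  by apply: fintype.subset_trans (reach_sub _ _ _) (reach_sub _ _ _).
have e1 b : reach n s (act (pd_block (n + s) true) b) = reach n s b.
  apply: (subset_inj_eq (@act_inj _ _ _)) b => b; rewrite -(e2 b).
  by apply: fintype.subset_trans (reach_sub_act _ _ _) (reach_sub _ _ _).
have e0 b : reach n s (act (pd_block (n + s) false) b) = reach n s b.
  apply: (subset_inj_eq (@act_inj _ _ _)) b => b.
  have [a <-] := act_surj (pd_block (n + s) true) b.
  by rewrite e1 -(e2 a); apply: reach_sub_act2.
have const := mix _ (reach n s) (fun c => if c as c return _ then e1 else e0).
by move=> b a; rewrite (const b a) mem_reach.
Qed.

(** The total size of the reachable sets is at most the square of the number of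
    states, and it increases every two levels until it is stable. *)
Definition mixing_time : nat := (#|{: state}| * #|{: state}|).+1.*2.

Lemma reach_full n b a : (forall m, n <= m -> mixing k M m) ->
  a \in reach n mixing_time b.
Proof.
move=> mix; pose Phi s := \sum_c #|reach n s c|.
have PhiS s : Phi s <= Phi s.+1.
  by apply: leq_sum => c _; apply/subset_leq_card/reach_sub.
have full s t : s <= t -> forall c, reach n s c \subset reach n t c.
  move=> st c; elim: t st => [|t IHt]; first by rewrite leqn0 => /eqP <-.
  rewrite leq_eqVlt => /orP[/eqP<-//|/IHt e].
  exact: fintype.subset_trans e (reach_sub _ _ _).
have [[s hs le]|none] :=
    pselect (exists2 s, s <= mixing_time & Phi s.+2 <= Phi s).
  apply: (fintype.subsetP (full _ _ hs b)); apply: reach_stable le _ _.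
  by apply: mix; apply: leq_addr.
have grow j : j.*2 <= mixing_time -> j <= Phi j.*2.
  elim: j => // j IHj hj; rewrite doubleS ltnNge; apply/negP => le.
  apply: none; exists j.*2; first by lia.
  by rewrite (leq_trans le) // IHj //; lia.
have := grow _ (leqnn mixing_time); rewrite leqNgt ltnS.
suff -> : Phi mixing_time <= #|{: state}| * #|{: state}| by [].
rewrite -sum_nat_const; apply: leq_sum => c _; exact: max_card.
Qed.

End Reach.

(** * Recurrence in the extension *)

Section Recurrence.
Variables (k M : nat).
Implicit Types (x : int -> 'Z_k) (y z : int -> bool).

(** The condition that the sliding block code sends [x] to [y]. *)
Definition lifts x y := forall n : int, x (n + M.+1%:Z) = x n + (y n)%:R.

Definition state_at x (a : int) : state k M := [ffun j : 'I_M.+1 => x (a + (j : nat)%:Z)].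

Lemma state_at_act x y a len : lifts x y ->
  state_at x (a + len%:Z) = act (subword_at y a len) (state_at x a).
Proof.
move=> xy; elim: len a => [|len IH] a; first by rewrite addr0.
rewrite -[len.+1]add1n subword_at_cat act_cat PoszD addrA IH; congr (act _ _).
have -> : subword_at y a 1 = [:: y a] by rewrite /subword_at /= addr0.
rewrite -[act _ _]/(step (state_at x a) (y a)); apply/ffunP => j.
rewrite !(ffunE, ffunMnE).
case: (unliftP ord_max j) => [j' ->|->].
  have hj := ltn_ord j'; rewrite -(inj_eq val_inj) /= /bump leqNgt hj add0n.
  rewrite [(_ == M)]ltn_eqF // mul0rn addr0 modn_small //.
  by congr x; lia.
rewrite eqxx /= modnn addr0; have -> : a + 1 + M%:Z = a + M.+1%:Z by lia.
exact: xy.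
Qed.

(** A lift is determined on an interval by its state on the left and by the base
    sequence. *)
Lemma lifts_agree x y x' y' a a' len : lifts x y -> lifts x' y' ->
  state_at x a = state_at x' a' ->
  subword_at y a len = subword_at y' a' len ->
  forall j, (j < len)%N -> x (a + j%:Z) = x' (a' + j%:Z).
Proof.
move=> xy xy' es ew j; elim/ltn_ind: j => j IHj jlen.
case: (ltnP j M.+1) => jM.
  by have /ffunP /(_ (Ordinal jM)) := es; rewrite !ffunE.
have -> : a + j%:Z = a + (j - M.+1)%:Z + M.+1%:Z by lia.
have -> : a' + j%:Z = a' + (j - M.+1)%:Z + M.+1%:Z by lia.
rewrite xy xy' IHj; [|lia|lia]; congr (_ + _ %:R).
have := congr1 (fun w => nth true w (j - M.+1)) ew.
by rewrite !nth_subword_at //; [move=> ->|lia|lia].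
Qed.

Lemma lifts_shiftz x y t : lifts x y -> lifts (shiftz t x) (shiftz t y).
Proof. by move=> xy n; rewrite /shiftz -xy; congr x; lia. Qed.

(** [0] is a cut of level [n] of the base sequence of [x]. *)
Definition aligned n x :=
  exists2 z, no_two_zeros z & lifts x (iter n pd_subst2 z).

Lemma aligned_shiftz n t x : aligned n x -> aligned n (shiftz ((2 ^ n)%:Z * t) x).
Proof.
case=> z hz xz; exists (shiftz t z); first exact: no_two_zeros_shiftz.
by rewrite -shiftz_iter_pd_subst2; apply: lifts_shiftz.
Qed.

Lemma aligned_pred n x : aligned n.+1 x -> aligned n x.
Proof.
case=> z hz; rewrite iterSr => xz.
by exists (pd_subst2 z) => //; apply: no_two_zeros_pd_subst2.
Qed.

Lemma aligned_leq m n x : (m <= n)%N -> aligned n x -> aligned m x.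
Proof.
move=> mn; rewrite -(subnKC mn); elim: (n - m)%N => [|d IHd]; first by rewrite addn0.
by rewrite addnS => /aligned_pred.
Qed.

Lemma state_at_shiftz x t a : state_at (shiftz t x) a = state_at x (a + t).
Proof. by apply/ffunP => j; rewrite !ffunE /shiftz addrAC. Qed.

Lemma aligned_act_true n x : aligned n.+1 x ->
  state_at x (2 ^ n)%:Z = act (pd_block n true) (state_at x 0).
Proof.
case=> z _; rewrite iterSr => xz.
rewrite -(pd_subst2_even z 0) mulr0 -subword_at_block mulr0.
by rewrite -(state_at_act _ _ xz) add0r.
Qed.

Lemma reach_visited n s x a : aligned (n + s) x ->
  a \in reach n s (state_at x 0) ->
  exists2 i, (i < 2 ^ s)%N & state_at x (2 ^ n * i)%:Z = a.
Proof.
elim: s x => [|s IHs] x hx /=.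
  by rewrite inE => /eqP ->; exists 0%N => //; rewrite muln0.
rewrite addnS in hx; rewrite inE => /orP[h|].
  have [i hi <-] := IHs x (aligned_pred hx) h.
  by exists i => //; rewrite expnS; lia.
rewrite -aligned_act_true //.
have := aligned_shiftz 1 (aligned_pred hx); rewrite mulr1 => hx'.
rewrite -[(2 ^ (n + s))%:Z in X in a \in X -> _]add0r -state_at_shiftz => h.
have [i hi <-] := IHs _ hx' h; exists (2 ^ s + i)%N.
  by rewrite expnS; lia.
by rewrite state_at_shiftz; congr state_at; rewrite expnD; lia.
Qed.

(** All three admissible pairs of letters occur in 1011, which begins every image
    under the third power of the substitution. *)
Lemma no_two_zeros_pair (c d : bool) : c || d ->
  exists2 j, (j < 3)%N &
    forall z, subword_at z 0 4 = [:: true; false; true; true] ->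
      subword_at z j%:Z 2 = [:: c; d].
Proof.
move=> cd; exists (if c then (if d then 2 else 0) else 1)%N.
  by case: c d cd => [] [].
move=> z hz.
have e i : (i < 4)%N -> z i%:Z = nth true [:: true; false; true; true] i.
  by move=> i4; rewrite -hz nth_subword_at // add0r.
by rewrite /subword_at /= addr0 -PoszD; case: c d cd => [] [] //= _; rewrite !e.
Qed.

Lemma subword_at_pd_subst2_3 z :
  subword_at (iter 3 pd_subst2 z) 0 4 = [:: true; false; true; true].
Proof. by []. Qed.

(** Three levels make all pairs of blocks appear, and [mixing_time] levels make
    every state appear in front of them. *)
Definition recurrence_time : nat := 3 + mixing_time k M.

(** Linear recurrence. The transition of the word that precedes the wanted pair of
    blocks is invertible, so its preimage of the state of [x'] is a state, and this
    state is reached at a cut of level [n + 3]. *)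
Lemma block_recurrence n x x' : (forall m, (n <= m)%N -> mixing k M m) ->
  aligned (n + recurrence_time) x -> aligned n x' ->
  exists2 i, (i < 2 ^ recurrence_time)%N &
    forall j, (j < 2 ^ n.+1)%N -> x ((2 ^ n * i)%:Z + j%:Z) = x' j%:Z.
Proof.
move=> mix; rewrite /recurrence_time addnA => hx [z' hz' xz'].
have [j0 j03 hj0] := no_two_zeros_pair (hz' 0).
pose w := iter n pd_subst (take j0 [:: true; false; true; true]).
have [b hb] := act_surj w (state_at x' 0).
have [i hi ib] : exists2 i, (i < 2 ^ mixing_time k M)%N &
    state_at x (2 ^ (n + 3) * i)%:Z = b.
  apply: reach_visited hx _; apply: reach_full => m hm.
  by apply: mix; lia.
exists (8 * i + j0)%N; first by rewrite expnD; lia.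
have : aligned (n + 3) (shiftz ((2 ^ (n + 3))%:Z * i%:Z) x).
  by apply: aligned_shiftz; apply: aligned_leq hx; apply: leq_addr.
move=> [z _]; rewrite iterD; set x1 := shiftz _ x; set z3 := iter 3 _ _ => x1z.
have z3E := subword_at_pd_subst2_3 z : subword_at z3 0 4 = _.
have st : state_at x1 (2 ^ n * j0)%:Z = state_at x' 0.
  rewrite -[(_ * _)%:Z]add0r (state_at_act _ _ x1z) -hb.
  rewrite subword_at_iter0.
  congr (act (iter _ _ _) _).
    rewrite -z3E; apply: (@eq_from_nth _ true).
      by rewrite size_take !size_subword_at; case: ltnP; lia.
    rewrite size_subword_at => j hj.
    by rewrite nth_take // !nth_subword_at //; lia.
  by rewrite -ib state_at_shiftz add0r; congr state_at; lia.
move=> j hj.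
have := @lifts_agree x1 _ x' _ (2 ^ n * j0)%:Z 0 (2 ^ n.+1) x1z xz' st _ j hj.
rewrite add0r => <-.
  by rewrite /x1 /shiftz; congr x; rewrite expnD; lia.
have -> : (2 ^ n * j0)%:Z = (2 ^ n)%:Z * j0%:Z by lia.
rewrite expnS mulnC subword_at_iter subword_at_iter0.
by rewrite hj0 // /subword_at /= addr0.
Qed.

End Recurrence.

(** * Existence of points *)

Lemma toeplitz_subr n m : (0 < m < 2 ^ n)%N -> toeplitz (2 ^ n - m) = toeplitz m.
Proof.
elim: n m => [|n IHn] m; first by case: m => [|[]].
move=> /andP[m0 mn]; have [om|em] := boolP (odd m).
  by rewrite !toeplitz_odd // oddB ?oddX ?om // ltnW.
have em' : m = m./2.*2 by rewrite even_halfK.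
move: m0 mn; rewrite em' expnS mul2n -doubleB double_gt0 ltn_double => m0 mn.
by rewrite !toeplitz_double ?IHn ?m0 // subn_gt0.
Qed.

(** A two-sided period doubling sequence: the 2-adic valuation is even under sign
    change, and the letter at -1 is one of the two possible ones. *)
Definition toeplitz_point (n : int) : bool := toeplitz `|(n + 1)%R|%N.

Lemma period_doubling_toeplitz : period_doubling toeplitz_point.
Proof.
(* Far enough on the right, translation by an even power of 2 preserves both the
   valuation of small nonzero integers and the letter given to 0. *)
apply/period_doublingP => a len; set K := (`|a| + len + 2)%N.
have hK : (K < 2 ^ K.*2)%N.
  by apply: (leq_ltn_trans _ (ltn_expl _ _)) => //; rewrite -addnn leq_addr.
exists `|((2 ^ K.*2)%:Z + a + 1)%R|%N; first by rewrite /K in hK *; lia.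
move=> i hi; rewrite /toeplitz_point.
have [pos|neg|zero] := ltgtP (a + i%:Z + 1) 0; last first.
- rewrite zero absz0; have -> : (`|((2 ^ K.*2)%:Z + a + 1)%R| + i = 2 ^ K.*2)%N.
    by lia.
  by rewrite /toeplitz pfactorK // odd_double.
- rewrite -(@toeplitz_addr K.*2); last by move: hK; rewrite {1}/K; lia.
  by congr toeplitz; move: hK; rewrite {1}/K; lia.
- rewrite -(@toeplitz_subr K.*2); last by move: hK; rewrite {1}/K; lia.
  by congr toeplitz; move: hK; rewrite {1}/K; lia.
Qed.

Lemma antidifference (V : zmodType) (g : int -> V) (a : V) :
  exists u : int -> V, u 0 = a /\ forall q : int, u (q + 1) = u q + g q.
Proof.
exists (fun q => match q with
  | Posz n => a + \sum_(0 <= i < n) g i%:Z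
  | Negz n => a - \sum_(0 <= i < n.+1) g (Negz i) end).
split=> [|[n|n]]; first by rewrite /= big_geq ?addr0.
  by rewrite -PoszD addn1 big_nat_recr //= addrA.
case: n => [|n].
  have -> : Negz 0 + 1 = 0%N by [].
  by rewrite /= big_geq // big_nat1 addr0 subrK.
have -> : Negz n.+1 + 1 = Negz n by lia.
by rewrite /= [in RHS]big_nat_recr //= opprD addrA subrK.
Qed.

Section Extension.
Variables (k M : nat).
Implicit Types (x : int -> 'Z_k) (y : int -> bool).

Lemma lifts_exists y (a : int -> 'Z_k) :
  exists2 x, lifts M x y & forall j, 0 <= j < M.+1%:Z -> x j = a j.
Proof.
have /choice[u hu] : forall j : int, exists u : int -> 'Z_k,
    u 0 = a j /\ forall q : int, u (q + 1) = u q + (y (q * M.+1%:Z + j))%:R.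
  by move=> j; apply: antidifference.
exists (fun n => u (n %% M.+1%:Z)%Z (n %/ M.+1%:Z)%Z) => [n|j hj].
  rewrite modzDr divzDr ?dvdzz // divzz /= (hu _).2; congr (_ + (y _)%:R).
  by rewrite -divz_eq.
by rewrite modz_small // divz_small //; apply: (hu _).1.
Qed.

Definition extension x := exists2 y, period_doubling y & lifts M x y.

Lemma extension_exists : exists x, extension x.
Proof.
have [x xy _] := lifts_exists toeplitz_point (fun=> 0).
by exists x, toeplitz_point => //; apply: period_doubling_toeplitz.
Qed.

Lemma extension_shiftz x t : extension x -> extension (shiftz t x).
Proof.
case=> y hy xy; exists (shiftz t y); first exact: period_doubling_shiftz.
exact: lifts_shiftz.
Qed.

Lemma extension_aligned n x : extension x ->
  exists2 t, (t < 2 ^ n)%N & aligned M n (shiftz t%:Z x).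
Proof.
case=> y /(pd_desubst_iter n)[t [z [ht hz yz]]] xy; exists t => //.
exists z; first exact: period_doubling_no_two_zeros.
by rewrite -yz; apply: lifts_shiftz.
Qed.

(** * Minimality of the extension *)

Section Mixing.
Variable n0 : nat.
Hypothesis mix : forall n, (n0 <= n)%N -> mixing k M n.

Lemma extension_visits x x' (W : nat) : extension x -> extension x' ->
  exists m : int, forall i : int, - W%:Z <= i <= W%:Z -> x (i + m) = x' i.
Proof.
move=> hx hx'; pose n := maxn n0 W.*2.
(* Moving back by [W + 2 ^ n] leaves room for a cut before the window, and
   keeps the window inside the two blocks that follow this cut. *)
have hn : (W.*2 < 2 ^ n)%N by apply: leq_ltn_trans (leq_maxr n0 _) (ltn_expl _ _).
have [t ht hxt] := extension_aligned n (extension_shiftz (- W%:Z - (2 ^ n)%:Z) hx').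
have [u _ hxu] := extension_aligned (n + recurrence_time k M) hx.
have mixn m : (n <= m)%N -> mixing k M m.
  by move=> nm; apply/mix/(leq_trans _ nm)/leq_maxl.
have [i _ hi] := block_recurrence mixn hxu hxt.
exists (u%:Z + (2 ^ n * i)%:Z - t%:Z + W%:Z + (2 ^ n)%:Z) => a ha.
have := hi `|(a - t%:Z + W%:Z + (2 ^ n)%:Z)%R|%N.
rewrite expnS => /(_ _) h.
have {}h := h ltac:(lia).
move: h; rewrite /shiftz => h; apply: etrans (etrans h _); congr (_ _); lia.
Qed.

(** * Uniform frequencies *)

Definition visits (f : (int -> 'Z_k) -> bool) x N : nat :=
  (\sum_(i < N) f (shiftz i%:Z x))%N.

Lemma visits_add f x m n :
  visits f x (m + n) = (visits f x m + visits f (shiftz m%:Z x) n)%N.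
Proof.
rewrite /visits big_split_ord /=; congr (_ + _)%N; apply: eq_bigr => i _.
by congr (nat_of_bool (f _)); apply/funext => j; rewrite /shiftz; congr x; lia.
Qed.

Lemma visits_le f x n : (visits f x n <= n)%N.
Proof.
rewrite -[leqRHS]card_ord -sum1_card; apply: leq_sum => i _; exact: leq_b1.
Qed.

Lemma visits_blocks f x m q :
  visits f x (m * q) = (\sum_(i < q) visits f (shiftz (m * i)%:Z x) m)%N.
Proof.
elim: q => [|q IH]; first by rewrite muln0 /visits !big_ord0.
by rewrite mulnS addnC visits_add IH big_ord_recr.
Qed.

Definition local_upto (W : nat) (f : (int -> 'Z_k) -> bool) :=
  forall x x', (forall j, (j < W)%N -> x j%:Z = x' j%:Z) -> f x = f x'.

Variables (W : nat) (f : (int -> 'Z_k) -> bool).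
Hypothesis f_local : local_upto W f.

(** [D] bounds the oscillation of the visit counts over blocks of level [n]. *)
Definition block_osc (n D : nat) := forall x x', aligned M n x -> aligned M n x' ->
  (visits f x (2 ^ n) <= visits f x' (2 ^ n) + D)%N.

(** Among the [2 ^ p] blocks of level [n] of [x], one agrees with the first block
    of [x'], and so do the two blocks that come after them. Windows of length [W]
    starting in the first of these blocks are then the same, so the counts over it
    are equal; the other blocks are paired arbitrarily and contribute [D] each. *)
Lemma block_osc_contract n D : (n0 <= n)%N -> (W <= 2 ^ n)%N -> block_osc n D ->
  block_osc (n + recurrence_time k M) ((2 ^ recurrence_time k M - 1) * D).
Proof.
move=> n0n Wn osc x x' hx hx'; set p := recurrence_time k M.
have al i x1 : aligned M (n + p) x1 -> aligned M n (shiftz (2 ^ n * i)%:Z x1).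
  by move=> h; rewrite PoszM; apply/aligned_shiftz; apply: aligned_leq h; apply: leq_addr.
have [i ip hi] := block_recurrence (fun m nm => mix (leq_trans n0n nm)) hx
  (aligned_leq (leq_addr _ _) hx').
rewrite expnD !visits_blocks.
pose i0 : 'I_(2 ^ p) := Ordinal ip.
pose o : 'I_(2 ^ p) := Ordinal (expn_gt0 2 p : (0 < 2 ^ p)%N).
have match0 : visits f (shiftz (2 ^ n * i)%:Z x) (2 ^ n)
            = visits f (shiftz (2 ^ n * 0)%:Z x') (2 ^ n).
  apply: eq_bigr => c _; congr nat_of_bool; apply: f_local => j hj.
  rewrite /shiftz muln0 addr0; have := hi (c + j)%N; rewrite expnS => h.
  have hc := ltn_ord c.
  have {}h := h ltac:(lia); apply: etrans (etrans h _); congr (_ _); lia.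
(* The transposition pairs the matching blocks. *)
rewrite (reindex_inj (@perm_inj _ (tperm o i0))) /=.
rewrite (bigD1 o) //= [in leqRHS](bigD1 o) //= tpermL match0 -addnA leq_add2l.
have -> : ((2 ^ p - 1) * D = \sum_(j < 2 ^ p | j != o) D)%N.
  by rewrite sum_nat_const cardC1 card_ord subn1.
by rewrite -big_split /=; apply: leq_sum => j _; apply: osc; apply: al.
Qed.

Lemma visits_mono g x m n : (m <= n)%N ->
  (visits g x m <= visits g x n <= visits g x m + (n - m))%N.
Proof.
move=> mn; rewrite -{1 2}(subnKC mn) visits_add leq_addr leq_add2l.
exact: visits_le.
Qed.

Lemma block_osc_exists j : exists n,
  block_osc (n + j * recurrence_time k M)
    ((2 ^ recurrence_time k M - 1) ^ j * 2 ^ n).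
Proof.
exists (maxn n0 W); elim: j => [|j IHj].
  move=> x x' _ _; rewrite mul0n addn0 expn0 mul1n.
  exact: leq_trans (visits_le _ _ _) (leq_addl _ _).
rewrite mulSn addnCA addnC expnS -mulnA; apply: block_osc_contract IHj.
  exact: leq_trans (leq_maxl _ _) (leq_addr _ _).
apply: leq_trans (ltnW (ltn_expl W (ltnSn 1))) _; rewrite leq_exp2l //.
exact: leq_trans (leq_maxr _ _) (leq_addr _ _).
Qed.

(** Cutting at level [n] leaves out less than a block at each end, and each full
    block contributes [c] up to [D]. *)
Lemma visits_bounds n D xr x N : block_osc n D -> aligned M n xr -> extension x ->
  let c := visits f xr (2 ^ n) in
  (2 ^ n * visits f x N <= N * (c + D) + 2 * 2 ^ n * 2 ^ n /\
   N * c <= 2 ^ n * visits f x N + N * D + 2 * 2 ^ n * 2 ^ n)%N.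
Proof.
move=> osc hxr hx c; have [t ht hxt] := extension_aligned n hx.
set B := (2 ^ n)%N in ht osc c *; set q := (N %/ B)%N.
have B0 : (0 < B)%N by rewrite expn_gt0.
pose S := visits f (shiftz t%:Z x) (B * q).
have blk i : aligned M n (shiftz (B * i)%:Z (shiftz t%:Z x)).
  by rewrite PoszM; apply: aligned_shiftz.
have sumq a : (\sum_(i < q) a = q * a)%N by rewrite sum_nat_const card_ord.
have S1 : (S <= q * (c + D))%N.
  rewrite /S visits_blocks -sumq.
  by apply: leq_sum => i _; apply: osc.
have S2 : (q * c <= S + q * D)%N.
  rewrite /S visits_blocks -!sumq -big_split /=.
  by apply: leq_sum => i _; apply: osc.
have tS : visits f x (t + B * q) = (visits f x t + S)%N by apply: visits_add.
have tB := leq_trans (visits_le f x t) (ltnW ht).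
have hN : (B * q <= N < B * q + B)%N.
  by rewrite mulnC leq_divM /= addnC -mulSn ltn_ceil.
have cB : (c <= B)%N by apply: visits_le.
have near : (visits f x N <= visits f x (t + B * q) + B
             /\ visits f x (t + B * q) <= visits f x N + B)%N.
  case/andP: hN => h1 h2.
  case: (leqP N (t + B * q)) => h.
    by have := visits_mono f x h; lia.
  by have := visits_mono f x (ltnW h); lia.
case: near => n1 n2; case/andP: hN => h1 h2; split.
  have : (visits f x N <= q * (c + D) + 2 * B)%N by lia.
  rewrite -(leq_pmul2l B0) => /leq_trans; apply.
  by rewrite mulnDr mulnA leq_add ?leq_mul2r ?h1 ?orbT //; nia.
have : (q * c <= visits f x N + B + q * D)%N by lia.
rewrite -(leq_pmul2l B0) => h.
have h3 : (N * c <= B * (q * c) + B * B)%N by nia.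
have h4 : (B * (q * D) <= N * D)%N by nia.
by apply: leq_trans h3 _; nia.
Qed.

End Mixing.
End Extension.

Section Frequency.
Variables (R : realType) (k M n0 : nat).
Hypothesis mix : forall n, (n0 <= n)%N -> mixing k M n.

Lemma frequency_estimate (B r e N c v : R) : 0 < B -> r <= e / 2 -> 0 <= N ->
  2 * B <= N * (e / 2) -> B * v <= N * (c + B * r) + 2 * B * B ->
  N * c <= B * v + N * (B * r) + 2 * B * B -> `|v - N * (c / B)| <= N * e.
Proof.
move=> B0 re N0 NB u l.
have h1 : N * (B * r) <= B * (N * (e / 2)).
  by rewrite mulrCA ler_pM2l // ler_wpM2l.
have h2 : 2 * B * B <= B * (N * (e / 2)) by rewrite [leLHS]mulrC ler_pM2l.
have cE : N * (c / B) * B = N * c by rewrite -mulrA divfK // gt_eqF.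
suff : `|(v - N * (c / B)) * B| <= N * e * B.
  by rewrite normrM (gtr0_norm B0) ler_pM2r.
by rewrite mulrBl cE ler_norml; apply/andP; split; nra.
Qed.

(** The relative oscillation over blocks of level [n + j * p] is at most
    [(1 - 2 ^ - p) ^ j]. *)
Lemma uniform_frequency W (f : (int -> 'Z_k) -> bool) (e : R) :
  local_upto W f -> 0 < e ->
  exists c : R, exists N0 : nat, forall N, (N0 <= N)%N ->
    forall x, extension M x -> `|(visits f x N)%:R - N%:R * c| <= N%:R * e.
Proof.
move=> fl e0; set p := recurrence_time k M.
pose r : R := (2 ^ p - 1)%N%:R / (2 ^ p)%N%:R.
have P0 : 0 < (2 ^ p)%N%:R :> R by rewrite ltr0n expn_gt0.
have r0 : 0 <= r by rewrite divr_ge0 // ltW.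
have r1 : `|r| < 1.
  by rewrite ger0_norm // ltr_pdivrMr // mul1r ltr_nat; have := expn_gt0 2 p; lia.
have [j hj] : exists j, r ^+ j <= e / 2.
  have /cvgr0_norm_le /(_ (e / 2)) h := cvg_expr r1.
  have [|j _ /(_ j (leqnn _))] := h _; first by rewrite divr_gt0.
  by exists j; apply: le_trans (ler_norm _) _.
have [n osc] := block_osc_exists mix fl j.
set m := (n + j * p)%N in osc.
have B0 : 0 < (2 ^ m)%N%:R :> R by rewrite ltr0n expn_gt0.
set D := ((_ - 1) ^ j * _)%N in osc.
have DE : D%:R = (2 ^ m)%N%:R * r ^+ j.
  rewrite /D /m natrM expnD natrM natrX expr_div_n -mulrA mulrC; congr (_ * _).
  by rewrite mulrCA mulnC expnM natrX divff ?mulr1 // expf_neq0 // gt_eqF.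
clearbody D.
have [x0 hx0] := extension_exists k M.
have [t _ hxt] := extension_aligned m hx0.
set xr := shiftz _ x0 in hxt; pose c := visits f xr (2 ^ m).
have bnd x N (hx : extension M x) := visits_bounds N osc hxt hx.
exists (c%:R / (2 ^ m)%N%:R), (Num.bound (2 * 2 * (2 ^ m)%N%:R / e)).
move=> N hN x hx; have [] := bnd x N hx; rewrite -/c.
rewrite -2!(ler_nat R) !natrD !natrM !natrD DE => u l.
apply: (frequency_estimate B0 hj (ler0n R N) _ u l).
have h0 : 0 <= 2 * 2 * (2 ^ m)%N%:R / e by rewrite divr_ge0 ?mulr_ge0 // ltW.
have := ltW (archi_boundP h0); rewrite -(ler_nat R) in hN.
move=> /le_trans /(_ hN); rewrite ler_pdivrMr // => h2.
by rewrite mulrA ler_pdivlMr // mulrC mulrA.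
Qed.

End Frequency.

(** * Clopen sets of the full shift *)

Section Cylinders.
Variable k : nat.
Implicit Types (x : full_shift k) (A : set (full_shift k)).

Definition agree (n : nat) x : set (full_shift k) :=
  [set x' | forall i : int, - n%:Z <= i <= n%:Z -> x i = x' i].

Lemma agree_le m n x : (m <= n)%N -> agree n x `<=` agree m x.
Proof. by move=> mn x' h i hi; apply: h; lia. Qed.

Lemma agree_refl n x : agree n x x.
Proof. by []. Qed.

Lemma nbhs_coord (i : int) x : nbhs x [set x' : full_shift k | x i = x' i].
Proof.
have c := @proj_continuous _ (fun _ : int => discrete_topology 'Z_k) i x.
have := c _ (discrete_set1 (x i : discrete_topology 'Z_k)).
have -> : [set x' : full_shift k | x i = x' i] = proj i @^-1` [set x i].
  by rewrite eqEsubset; split => x' /= h; exact: esym h.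
exact.
Qed.

Lemma nbhs_agree n x : nbhs x (agree n x).
Proof.
elim: n => [|n IHn].
  by apply: filterS (nbhs_coord 0 x) => x' h i hi; have -> : i = 0 by lia.
apply: filterS (filterI IHn (filterI (nbhs_coord n.+1%:Z x)
  (nbhs_coord (- n.+1%:Z) x))) => x' [h [hp hn]] i hi.
have [->//|np] := eqVneq i n.+1%:Z; have [->//|nn] := eqVneq i (- n.+1%:Z).
by apply: h; lia.
Qed.

(** The filter generated by the windows of [x] converges to [x] coordinate by
    coordinate, hence in the product. *)
Lemma agree_nbhs x U : nbhs x U -> exists n, agree n x `<=` U.
Proof.
pose F : set_system (full_shift k) := [set V | exists n, agree n x `<=` V].
have FF : Filter F.
  split; first by exists 0%N.
  - move=> P Q [m hm] [n hn]; exists (maxn m n) => x' h; split.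
      by apply: hm; apply: agree_le h; rewrite leq_maxl.
    by apply: hn; apply: agree_le h; rewrite leq_maxr.
  - by move=> P Q PQ [n hn]; exists n => x' /hn/PQ.
suff : F --> x by move=> /(_ U).
apply/cvg_sup => i; apply/cvg_image.
  by rewrite eqEsubset; split => v // _; exists (fun=> v).
move=> V Vx; exists (proj i @^-1` V); last first.
  by rewrite image_preimage // eqEsubset; split => v // _; exists (fun=> v).
exists `|i|%N => x' h; rewrite /preimage /= /proj -(h i); last by lia.
exact: nbhs_singleton Vx.
Qed.

Definition window_set A :=
  exists n, forall x x', agree n x x' -> A x -> A x'.

Lemma window_set_open A : window_set A -> open A.
Proof.
move=> [n hn]; rewrite openE => x Ax; apply: filterS (nbhs_agree n x).
by move=> x' h; apply: hn h Ax.
Qed.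

Lemma window_set0 : window_set set0.
Proof. by exists 0%N. Qed.

Lemma window_setC A : window_set A -> window_set (~` A).
Proof.
by move=> [n hn]; exists n => x x' h nA A'; apply: nA; apply: hn A' => i /h.
Qed.

Lemma window_setU A B : window_set A -> window_set B -> window_set (A `|` B).
Proof.
move=> [m hm] [n hn]; exists (maxn m n) => x x' h [/hm|/hn] H; [left|right].
  by apply: H; apply: agree_le h; rewrite leq_maxl.
by apply: H; apply: agree_le h; rewrite leq_maxr.
Qed.

Lemma window_setI A B : window_set A -> window_set B -> window_set (A `&` B).
Proof.
move=> /window_setC hA /window_setC hB; rewrite -[A `&` B]setCK setCI.
exact/window_setC/window_setU.
Qed.

Lemma window_set_shift m A : window_set A -> window_set (shiftz m @^-1` A).
Proof.
move=> [n hn]; exists (n + `|m|)%N => x x' h; apply: hn => i hi.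
by apply: h; lia.
Qed.

(** An open set is the increasing union of the sets of points whose windows
    force membership, and these depend on finitely many coordinates. *)
Lemma open_window_bigcup A : open A ->
  exists2 F : (set (full_shift k))^nat,
    (forall n, window_set (F n)) & A = \bigcup_n F n.
Proof.
move=> oA; exists (fun n => [set x | agree n x `<=` A]).
  move=> n; exists n => x x' h hx x'' h'; apply: hx => i hi.
  by rewrite h // h'.
rewrite eqEsubset; split => x; last by move=> [n _]; apply; apply: agree_refl.
by move=> Ax; have [n hn] := agree_nbhs (open_nbhs_nbhs (conj oA Ax)); exists n.
Qed.

Lemma full_shift_compact : compact [set: full_shift k].
Proof.
have := @tychonoff int (fun=> discrete_topology 'Z_k) (fun=> setT).
have -> : [set f : int -> discrete_topology 'Z_k |
    forall i, [set: discrete_topology 'Z_k] (f i)] = setT.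
  by rewrite eqEsubset; split.
apply=> _; apply: finite_compact.
exact: (@finite_finset 'Z_k).
Qed.

Lemma window_set_compact A : window_set A -> compact A.
Proof.
move=> wA; apply: subclosed_compact full_shift_compact _ => //.
by rewrite -[A]setCK; apply/open_closedC/window_set_open/window_setC.
Qed.

(** By compactness a clopen set is never a disjoint union of infinitely many
    nonempty clopen sets; this is the source of sigma-additivity. *)
Lemma window_trivIset_bigcup (F : (set (full_shift k))^nat) :
  (forall n, window_set (F n)) -> trivIset setT F -> window_set (\bigcup_n F n) ->
  exists N, forall n, (N <= n)%N -> F n = set0.
Proof.
move=> wF tF wU; have := window_set_compact wU; rewrite compact_cover => cU.
have [|D' _ hD] := cU nat setT F (fun i _ => window_set_open (wF i)).
  by [].
exists (\max_(i <- finmap.enum_fset D') i).+1 => n hn.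
rewrite -subset0 => x Fx; have [|m mD Fm] := hD x; first by exists n.
have : (m < n)%N by apply: leq_ltn_trans hn; apply: leq_bigmax_seq.
have /trivIsetP /(_ m n I I) t := tF.
by rewrite ltn_neqAle => /andP[/t e _]; rewrite -e; split.
Qed.

End Cylinders.

(** * Unique ergodicity from uniform frequencies *)

(** A copy of the full shift, whose algebra of measurable sets consists of the sets
    that depend on finitely many coordinates. *)
Definition window_algebra (k : nat) : Type := full_shift k.

HB.instance Definition _ (k : nat) :=
  Pointed.copy (window_algebra k) (full_shift k).
HB.instance Definition _ (k : nat) :=
  @isAlgebraOfSets.Build default_measure_display (window_algebra k)
    (@window_set k) (@window_set0 k) (@window_setU k) (@window_setC k).

Lemma window_set_borel k (A : set (borel_shift k)) : window_set A -> measurable A.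
Proof. by move=> wA; apply: sub_sigma_algebra; apply: window_set_open. Qed.

(** Open sets are countable unions of window sets. *)
Lemma borel_windowE k :
  (measurable : set (set (borel_shift k))) = <<s @window_set k >>.
Proof.
rewrite eqEsubset; split; apply: smallest_sub.
- exact: smallest_sigma_algebra.
- move=> A /open_window_bigcup[F wF ->].
  apply: (@sigma_algebra_bigcup _ setT) => // n; exact: sub_sigma_algebra.
- exact: sigma_algebra_measurable.
- exact: window_set_borel.
Qed.

Lemma borel_measure_unique k (R : realType)
    (m1 m2 : {measure set (borel_shift k) -> \bar R}) :
  (m1 setT < +oo)%E -> (forall A, window_set A -> m1 A = m2 A) ->
  forall A, measurable A -> m1 A = m2 A.
Proof.
move=> fin e A mA; apply: (@measure_unique _ R (borel_shift k) (@window_set k) (fun=> setT)) => //.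
- exact: borel_windowE.
- exact: window_setI.
- by move=> _; exists 0%N.
- by rewrite bigcup_const.
Qed.

Lemma measurable_shiftz k m :
  measurable_fun [set: borel_shift k] (shiftz m : borel_shift k -> borel_shift k).
Proof.
apply: (@measurability _ _ (borel_shift k) (borel_shift k) setT _ _
  (borel_windowE k)).
move=> _ [A wA <-]; rewrite setTI; apply: window_set_borel.
exact: window_set_shift.
Qed.

Section UniquelyErgodic.
Variables (R : realType) (k : nat) (X : set (full_shift k)).
Hypothesis X_shift : forall m x, X x -> X (shiftz m x).
Hypothesis X_closed : forall x, (forall n, exists2 x', X x' & agree n x x') -> X x.

Definition indic_bool (A : set (full_shift k)) (x : int -> 'Z_k) : bool := `[< A x >].

Local Notation count A := (visits (indic_bool A)).

Hypothesis X_freq : forall A, window_set A -> forall e : R, 0 < e ->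
  exists c : R, exists N0 : nat, forall N, (N0 <= N)%N ->
    forall x, X x -> `|(count A x N)%:R - N%:R * c| <= N%:R * e.

Variable x0 : full_shift k.
Hypothesis Xx0 : X x0.

Definition mean (A : set (full_shift k)) (N : nat) : R := (count A x0 N)%:R / N%:R.
Definition freq (A : set (full_shift k)) : R := limn (mean A).

Lemma mean_close A c e N : (0 < N)%N ->
  `|(count A x0 N)%:R - N%:R * c| <= N%:R * e -> `|c - mean A N| <= e.
Proof.
move=> N0; have N0' : 0 < N%:R :> R by rewrite ltr0n.
rewrite distrC => h; rewrite -(ler_pM2l N0') -{1}(gtr0_norm N0') -normrM mulrBr.
by rewrite /mean [_ / _]mulrC mulrA divff ?gt_eqF // mul1r.
Qed.

Lemma mean_cvg A : window_set A -> mean A @ \oo --> freq A.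
Proof.
move=> wA; suff : cvgn (mean A) by [].
apply/cauchy_cvgP/cauchy_exP => e e0.
have [c [N0 h]] := X_freq wA (divr_gt0 e0 (ltr0n _ 2)).
exists c; exists (maxn N0 1) => // N; rewrite /= geq_max => /andP[hN N1].
apply: le_lt_trans (mean_close N1 (h _ hN _ Xx0)) _.
by rewrite ltr_pdivrMr // ltr_pMr // ltr1n.
Qed.

Lemma freq_uniform A : window_set A -> forall e : R, 0 < e ->
  exists N0 : nat, forall N, (N0 <= N)%N ->
    forall x, X x -> `|(count A x N)%:R - N%:R * freq A| <= N%:R * e.
Proof.
move=> wA e e0; have e4 : 0 < e / 3 by rewrite divr_gt0.
have [c [N0 h]] := X_freq wA e4; exists N0 => N hN x Xx.
have cf : `|c - freq A| <= e / 3 + e / 3.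
  have /cvgr_dist_le /(_ _ e4) [m _ hm] := mean_cvg wA.
  have hm' := hm (maxn m (maxn N0 1)) (leq_maxl _ _).
  have hc := mean_close (_ : 0 < maxn m (maxn N0 1))%N (h _ _ _ Xx0).
  rewrite -(subrKA (mean A (maxn m (maxn N0 1)))) (le_trans (ler_normD _ _)) //.
  rewrite lerD // ?hc ?leq_max ?leqnn ?orbT //.
  by rewrite distrC.
rewrite -(subrKA (N%:R * c)) (le_trans (ler_normD _ _)) // -mulrBr normrM normr_nat.
have -> : N%:R * e = N%:R * (e / 3) + N%:R * (e / 3 + e / 3) :> R by field.
by rewrite lerD ?h // ler_wpM2l.
Qed.

Lemma freq_unique A c : window_set A ->
  (forall e, 0 < e -> exists N0 : nat, forall N, (N0 <= N)%N ->
    `|(count A x0 N)%:R - N%:R * c| <= N%:R * e) -> freq A = c.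
Proof.
move=> wA h; apply: (@cvg_unique _ (@Rhausdorff R)) (mean_cvg wA) _.
apply/cvgrPdist_le => e /h [N0 hN].
exists (maxn N0 1) => // N; rewrite /= geq_max => /andP[h0 h1].
exact: mean_close h1 (hN _ h0).
Qed.

Lemma freq_ge0 A : window_set A -> 0 <= freq A.
Proof.
move=> wA; apply: limr_ge; first exact: mean_cvg.
by apply: nearW => N; rewrite divr_ge0.
Qed.

Lemma freqU A B : window_set A -> window_set B -> A `&` B = set0 ->
  freq (A `|` B) = freq A + freq B.
Proof.
move=> wA wB AB; apply: (@cvg_unique _ (@Rhausdorff R)) (mean_cvg (window_setU wA wB)) _.
have -> : mean (A `|` B) = mean A \+ mean B.
  apply/funext => N; rewrite /mean /= -mulrDl -natrD; congr (_%:R / _).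
  rewrite /visits -big_split; apply: eq_bigr => i _ /=; rewrite /indic_bool.
  set x := shiftz _ _; have nAB : ~ (A x /\ B x).
    by move=> h; have : (A `&` B) x by []; rewrite AB.
  rewrite asbool_or; case: asboolP => hA; case: asboolP => hB //.
  by case: nAB.
exact: cvgD (mean_cvg wA) (mean_cvg wB).
Qed.

Lemma freq_sub1 A : window_set A -> X `<=` A -> freq A = 1.
Proof.
move=> wA XA; apply: freq_unique => // e e0; exists 0%N => N _.
have -> : count A x0 N = N.
  rewrite /visits (eq_bigr (fun=> 1%N)) ?sum1_card ?card_ord // => i _.
  by rewrite /indic_bool asboolT //; apply/XA/X_shift.
by rewrite mulr1 subrr normr0 mulr_ge0 // ltW.
Qed.

Lemma freq0 : freq set0 = 0.
Proof.
apply: freq_unique => [|e e0]; first exact: window_set0.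
exists 0%N => N _; rewrite /visits big1 => [|i _].
  by rewrite mulr0 subrr normr0 mulr_ge0 // ltW.
by rewrite /indic_bool asboolF.
Qed.

Lemma freq_shift A : window_set A -> freq (shiftz 1 @^-1` A) = freq A.
Proof.
move=> wA; apply: freq_unique => [|e e0]; first exact: window_set_shift.
have [N0 h] := freq_uniform wA e0; exists N0 => N hN.
have -> : count (shiftz 1 @^-1` A) x0 N = count A (shiftz 1 x0) N.
  apply: eq_bigr => i _; congr (nat_of_bool (asbool (A _))).
  by apply/funext => j; rewrite /shiftz addrAC.
by apply: h => //; apply: X_shift.
Qed.

(** The absolute value makes this function nonnegative on all sets, also where the
    limit does not exist. *)
Definition freq_content (A : set (window_algebra k)) : \bar R := `|freq A|%:E.

Lemma freq_contentE A : window_set A -> freq_content A = (freq A)%:E.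
Proof. by move=> wA; rewrite /freq_content ger0_norm // freq_ge0. Qed.

Lemma freq_content0 : freq_content set0 = 0%E.
Proof. by rewrite freq_contentE ?freq0 //; exact: window_set0. Qed.

Lemma freq_content_ge0 A : (0 <= freq_content A)%E.
Proof. by rewrite lee_fin. Qed.

Lemma window_set_bigsetU (F : (set (full_shift k))^nat) n :
  (forall i, window_set (F i)) -> window_set (\big[setU/set0]_(i < n) F i).
Proof.
move=> wF; elim: n => [|n IHn]; first by rewrite big_ord0; apply: window_set0.
by rewrite big_ord_recr /=; apply: window_setU.
Qed.

Lemma freq_content_bigsetU (F : (set (full_shift k))^nat) n :
  (forall i, window_set (F i)) -> trivIset setT F ->
  freq_content (\big[setU/set0]_(i < n) F i) = (\sum_(0 <= i < n) freq_content (F i))%E.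
Proof.
move=> wF tF; elim: n => [|n IHn].
  by rewrite big_ord0 big_geq // freq_content0.
rewrite big_nat_recr //= -IHn big_ord_recr /=.
have wU := window_set_bigsetU n wF.
rewrite !freq_contentE //; last exact: window_setU.
rewrite freqU //.
rewrite -bigcup_mkord -subset0 => x [[m /= mn Fm] Fn].
have /trivIsetP /(_ m n I I) t := tF.
have /t e : m != n by rewrite ltn_eqF.
by have : (F m `&` F n) x by []; rewrite e.
Qed.

(** Countable disjoint unions within the algebra are finite by compactness, so
    finite additivity is enough. *)
Lemma freq_content_sigma_additive :
  semi_sigma_additive (freq_content : set (window_algebra k) -> \bar R).
Proof.
move=> F wF tF wU; have [N hN] := window_trivIset_bigcup wF tF wU.
have UE n : (N <= n)%N -> \bigcup_n F n = \big[setU/set0]_(i < n) F i.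
  move=> Nn; rewrite -bigcup_mkord eqEsubset; split=> x [m _ Fm]; last by exists m.
  exists m => //=; apply: leq_trans Nn; rewrite ltnNge; apply/negP => /hN e.
  by rewrite e in Fm.
apply: cvg_near_cst; exists N => // n /= Nn.
by rewrite (UE n Nn) freq_content_bigsetU.
Qed.

HB.instance Definition _ := isMeasure.Build _ (window_algebra k) R freq_content
  freq_content0 freq_content_ge0 freq_content_sigma_additive.

Definition freq_measure (A : set (borel_shift k)) : \bar R :=
  measure_extension [the measure _ _ of freq_content] A.

Lemma freq_measure_sigma_additive : semi_sigma_additive freq_measure.
Proof.
have g A : measurable (A : set (borel_shift k)) ->
    measurable (A : set (g_sigma_algebraType (@measurable _ (window_algebra k)))).
  by rewrite borel_windowE.
move=> F mF tF mU.
by apply: measure_semi_sigma_additive => // [i|]; apply: g.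
Qed.

Lemma freq_measureE A : window_set A -> freq_measure A = (freq A)%:E.
Proof.
move=> wA; rewrite -freq_contentE //.
by rewrite /freq_measure /measure_extension measurable_mu_extE.
Qed.

HB.instance Definition _ := isMeasure.Build _ (borel_shift k) R freq_measure
  (measure0 _) (fun=> measure_ge0 _ _) freq_measure_sigma_additive.

Lemma freq_measureT : freq_measure setT = 1%E.
Proof. by rewrite freq_measureE ?freq_sub1 //; exists 0%N. Qed.

HB.instance Definition _ := Measure_isProbability.Build _ (borel_shift k) R
  freq_measure freq_measureT.

(** Window sets of frequency 1 that decrease to [X]. *)
Definition approximable (n : nat) : set (full_shift k) :=
  [set x | exists2 x', X x' & agree n x x'].

Lemma window_set_approximable n : window_set (approximable n).
Proof.
exists n => x x' h [x'' Xx'' h']; exists x'' => // i hi.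
by rewrite -h // h'.
Qed.

Lemma sub_approximable n : X `<=` approximable n.
Proof. by move=> x Xx; exists x. Qed.

Lemma invariantE : X = \bigcap_n approximable n.
Proof.
rewrite eqEsubset; split=> [x Xx n _|x h]; first exact: sub_approximable.
by apply: X_closed => n; apply: h.
Qed.

Lemma measurable_invariant : measurable (X : set (borel_shift k)).
Proof.
rewrite invariantE; apply: bigcapT_measurable => n.
exact: window_set_borel (window_set_approximable n).
Qed.

Lemma freq_measure_invariant :
  invariant_probability_on X [the probability _ _ of freq_measure].
Proof.
split.
  have mC : measurable (~` X : set (borel_shift k)).
    exact: measurableC measurable_invariant.
  suff C0 : freq_measure (~` X) = 0%E.
    have := @probability_setC _ _ _ [the probability _ _ of freq_measure] _ mC.
    by rewrite setCK /= C0 sube0.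
  have mA n : measurable (~` approximable n : set (borel_shift k)).
    exact: measurableC (window_set_borel (window_set_approximable n)).
  apply/eqP; rewrite eq_le measure_ge0 andbT.
  apply: (@le_trans _ _ (\sum_(0 <= n <oo) freq_measure (~` approximable n))%E).
    apply: measure_sigma_subadditive => //.
    by rewrite invariantE setC_bigcap.
  rewrite eseries0 // => n _ _.
  have := @probability_setC _ _ _ [the probability _ _ of freq_measure] _
    (window_set_borel (window_set_approximable n)).
  move=> /= ->; rewrite freq_measureE; last exact: window_set_approximable.
  rewrite freq_sub1 ?subee //; first exact: window_set_approximable.
  exact: sub_approximable.
move=> A mA.
have mf := @measurable_shiftz k 1.
apply: (@borel_measure_unique k R (pushforward freq_measure
    (shiftz 1 : borel_shift k -> borel_shift k)) freq_measure _ _ A mA).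
- by rewrite /= /pushforward preimage_setT freq_measureT ltry.
- move=> B wB; rewrite /= /pushforward.
  rewrite !freq_measureE ?freq_shift //; exact: window_set_shift.
Qed.

(** The integral over [X] of the number of visits to [A] before time [N] is
    [N * nu A], and the integrand is at most [N * (freq A + e)] for large [N]. *)
Lemma invariant_le_freq (nu : probability (borel_shift k) R) A :
  invariant_probability_on X nu -> window_set A -> (nu A <= (freq A)%:E)%E.
Proof.
move=> [nuX inv] wA.
have mX := measurable_invariant.
have mS m : measurable (shiftz m @^-1` A : set (borel_shift k)).
  exact: window_set_borel (window_set_shift m wA).
have nuS (i : nat) : nu (shiftz i%:Z @^-1` A) = nu A.
  elim: i => [|i IHi].
    congr (nu _); apply/funext => x; rewrite /preimage /= /shiftz; congr (A _).
    by apply/funext => n; rewrite addr0.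
  rewrite -IHi -(inv _ (mS i)); congr (nu _); apply/funext => x.
  rewrite /preimage /=; congr (A _); apply/funext => n.
  by rewrite /shiftz; congr x; lia.
have nuI (B : set (borel_shift k)) : measurable B -> nu (B `&` X) = nu B.
  move=> mB; apply/esym; apply: etrans (measureDI nu mB mX) _.
  rewrite [X in (X + _)%E](_ : _ = 0%E) ?add0e //.
  apply/eqP; rewrite eq_le measure_ge0 andbT.
  have <- : nu (~` X) = 0%E by rewrite probability_setC // nuX subee.
  apply: le_measure; rewrite ?inE //; [exact: measurableD|exact: measurableC].
have nuf : nu A \is a fin_num by apply: fin_num_measure; apply: window_set_borel.
rewrite -(fineK nuf) lee_fin; apply/ler_addgt0Pr => e e0.
have [N0 hN] := freq_uniform wA e0.
pose N := N0.+1; have N0' : 0 < N%:R :> R by rewrite ltr0n.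
have := hN N (leqnSn _) => {}hN.
rewrite -(ler_pM2l N0') -lee_fin EFinM fineK //.
have -> : (N%:R%:E * nu A)%E =
    (\int[nu]_(x in X) (\sum_(i < N) (\1_(shiftz i%:Z @^-1` A) x)%:E))%E.
  rewrite ge0_integral_sum //; last first.
    by move=> i; apply/measurable_EFinP; apply: measurable_indic.
  rewrite (eq_bigr (fun=> nu A)) => [|i _].
    by rewrite sumr_const card_ord mule_natl.
  by rewrite integral_indic //; apply: etrans (nuI _ (mS i)) (nuS i).
have -> : (N%:R * (freq A + e))%:E = (\int[nu]_(x in X) (N%:R * (freq A + e))%:E)%E.
  by rewrite integral_cst // [X in (_ * X)%E](_ : _ = 1%E) ?mule1.
apply: ge0_le_integral => //.
- by move=> x _; apply: sume_ge0 => i _; rewrite lee_fin.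
- apply: emeasurable_sum => i.
  by apply/measurable_EFinP; apply: measurable_indic.
move=> x Xx; rewrite sumEFin lee_fin.
have := hN _ Xx; rewrite mulrDr => /(le_trans (ler_norm _)).
rewrite lerBlDl /visits natr_sum; apply: le_trans; apply: ler_sum => i _.
rewrite indicE; suff -> : (x \in shiftz i%:Z @^-1` A) = indic_bool A (shiftz i%:Z x) by [].
by apply/idP/asboolP => [/set_mem|/mem_set].
Qed.

(** The limit frequencies extend to a measure. Any other invariant measure is at most
    the frequency on each window set, and on its complement, so it is equal to it. *)
Lemma uniform_freq_uniquely_ergodic : uniquely_ergodic R X.
Proof.
exists [the probability _ _ of freq_measure]; first exact: freq_measure_invariant.
move=> nu hnu; apply: borel_measure_unique => [|A wA].
  by rewrite [X in (X < _)%E](_ : _ = 1%E) ?ltry //; exact: probability_setT.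
rewrite /= freq_measureE //; apply/eqP; rewrite eq_le invariant_le_freq //=.
have wC := window_setC wA; have := invariant_le_freq hnu wC.
rewrite probability_setC; last exact: window_set_borel.
have -> : freq (~` A) = 1 - freq A.
  apply/eqP; rewrite -subr_eq0 opprB addrA subr_eq0 addrC -freqU ?setICr //.
  by rewrite setUv freq_sub1 //; exists 0%N.
have nuf : nu A \is a fin_num by apply: fin_num_measure; apply: window_set_borel.
by rewrite -(fineK nuf) -EFinB !lee_fin lerD2l lerN2.
Qed.

End UniquelyErgodic.

(** * The extension as a subshift *)

Section Strict.
Variables (k M : nat).
Hypothesis k_gt1 : (1 < k)%N.
Local Notation X := (eta_code k M.+2 @^-1` X_pd k : set (full_shift k)).

Lemma bool_natr_eq0 (b : bool) : ((b%:R : 'Z_k) == 0) = ~~ b.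
Proof. by case: b; rewrite ?eqxx ?oner_eq0. Qed.

Lemma extensionP (x : full_shift k) : X x <-> extension M x.
Proof.
have e (n : int) : n + M.+1%:Z = n + M.+2%:Z - 1 by lia.
split=> [[y hy yx]|[y hy xy]]; exists y => //.
  by move=> n; have /(congr1 (fun f => f n)) -> := yx; rewrite /eta_code e [RHS]addrC subrK.
by apply/funext => n; rewrite /eta_code -e xy addrAC subrr add0r.
Qed.

(** The base sequence is read off from [x] letter by letter, and on each window it
    is the base sequence of an approximating point. *)
Lemma extension_closed (x : full_shift k) :
  (forall n, exists2 x', extension M x' & agree n x x') -> extension M x.
Proof.
move=> h; pose y (n : int) := x (n + M.+1%:Z) - x n != 0.
have win (n : nat) : exists2 y', period_doubling y' &
    forall i : int, - n%:Z <= i <= n%:Z ->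
      y i = y' i /\ x (i + M.+1%:Z) = x i + (y' i)%:R.
  have [x' [y' hy' xy'] a] := h (n + M.+1)%N; exists y' => // i hi.
  have e : x (i + M.+1%:Z) = x i + (y' i)%:R by rewrite !a ?xy' //; lia.
  by split=> //; rewrite /y e addrAC subrr add0r bool_natr_eq0 negbK.
exists y.
  move=> a len; have [y' hy' e] := win (`|a| + len)%N.
  have -> : subword_at y a len = subword_at y' a len; last exact: hy'.
  apply/eq_in_map => i; rewrite mem_iota => hi.
  by have [] := e (a + i%:Z); lia.
by move=> n; have [y' _ e] := win `|n|%N; have [|-> ->] := e n; first by lia.
Qed.

Lemma extension_minimal n0 : (forall n, (n0 <= n)%N -> mixing k M n) -> minimal X.
Proof.
move=> mix x /extensionP hx x' /extensionP hx' B /agree_nbhs[n hn].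
have [m hm] := extension_visits mix n hx hx'.
exists (shiftz m x); split; first by exists m.
by apply: hn => i hi; rewrite /shiftz hm.
Qed.

Lemma extension_uniquely_ergodic (R : realType) n0 :
  (forall n, (n0 <= n)%N -> mixing k M n) -> uniquely_ergodic R X.
Proof.
move=> mix; have [x0 /extensionP hx0] := extension_exists k M.
apply: (uniform_freq_uniquely_ergodic _ _ _ hx0).
- by move=> m x /extensionP /(extension_shiftz m) /extensionP.
- move=> x h; apply/extensionP/extension_closed => n.
  by have [x' /extensionP hx' a] := h n; exists x'.
move=> A [n hA] e e0.
(* Shifting by [n] turns a two-sided window into one that starts at 0. *)
pose f (x : int -> 'Z_k) := indic_bool A (shiftz n%:Z x).
have fl : local_upto n.*2.+1 f.
  move=> x x' h; apply/asbool_equiv_eq; split; apply: hA => i hi;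
    rewrite /shiftz; have -> : i + n%:Z = `|(i + n%:Z)%R|%N%:Z by lia.
    by apply: h; lia.
  by apply/esym/h; lia.
have [c [N0 h]] := uniform_frequency mix fl e0.
exists c, N0 => N hN x /extensionP /(extension_shiftz (- n%:Z)) /(h N hN).
have -> // : visits f (shiftz (- n%:Z) x) N = visits (indic_bool A) x N.
apply: eq_bigr => i _; congr (nat_of_bool (asbool (A _))).
by apply/funext => j; rewrite /shiftz; congr x; lia.
Qed.

(** * Non-minimal cases *)

Lemma minimal_visits (x x' : full_shift k) (n : nat) : minimal X -> X x -> X x' ->
  exists m : int, forall i : int, - n%:Z <= i <= n%:Z -> x (i + m) = x' i.
Proof.
move=> min Xx Xx'; have [z [[m _ <-] h]] := min x Xx x' Xx' _ (nbhs_agree n x').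
by exists m => i hi; rewrite h.
Qed.

Lemma toeplitz_point_even (i : int) : toeplitz_point (2 * i).
Proof. by apply: toeplitz_odd; lia. Qed.

Lemma toeplitz_point_4_1 (i : int) : toeplitz_point (4 * i + 1) = false.
Proof.
rewrite /toeplitz_point.
have [j ->] : exists j, `|(4 * i + 1 + 1)%R|%N = j.*2.+1.*2.
  by exists (`|(2 * i + 1)%R|%N)./2; lia.
by rewrite toeplitz_double // toeplitz_odd //= odd_double.
Qed.

(** The base point is 1 at even positions and 0 at the positions 1 mod 4, and it is
    1 at 3. So a shift that preserves its letters at 1 and 3 is a multiple of 4. *)
Lemma toeplitz_point_match (x x' : full_shift k) : minimal X -> lifts M x toeplitz_point ->
  lifts M x' toeplitz_point -> exists m : int,
  forall i : int, 0 <= i <= M.+4%:Z -> x (i + 4 * m) = x' i.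
Proof.
move=> min xy xy'.
have hX (z : full_shift k) : lifts M z toeplitz_point -> X z.
  by move=> zy; apply/extensionP; exists toeplitz_point => //; apply: period_doubling_toeplitz.
have [m hm] := minimal_visits M.+4 min (hX _ xy) (hX _ xy').
have hy (i : int) : 0 <= i <= 3 -> toeplitz_point (i + m) = toeplitz_point i.
  move=> hi; have e : (toeplitz_point (i + m))%:R = (toeplitz_point i)%:R :> 'Z_k.
    apply: (addrI (x' i)); rewrite -xy' -!hm -?xy; [congr x; lia|lia|lia].
  move: (bool_natr_eq0 (toeplitz_point (i + m))).
  by rewrite e bool_natr_eq0 => /negb_inj.
have m2 : (m %% 2)%Z = 0.
  apply/eqP/negPn/negP => h; have := hy 1 isT.
  have -> : 1 + m = 2 * ((m + 1) %/ 2)%Z by lia.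
  by rewrite toeplitz_point_even (toeplitz_point_4_1 0).
have m4 : (m %% 4)%Z = 0.
  apply/eqP/negPn/negP => h; have := hy 3 isT.
  have -> : 3 + m = 4 * ((m + 2) %/ 4)%Z + 1 by lia.
  by rewrite toeplitz_point_4_1.
by exists (m %/ 4)%Z => i hi; rewrite -hm; [congr x; lia|lia].
Qed.

(** On even positions the base sequence is constant 1. *)
Lemma lifts_even (x : full_shift k) (i q : int) : odd M -> lifts M x toeplitz_point ->
  x (2 * i + q * M.+1%:Z) = x (2 * i) + q%:~R.
Proof.
move=> oM xy.
have st (n : int) : x (2 * n + M.+1%:Z) = x (2 * n) + 1.
  by rewrite xy toeplitz_point_even.
pose h : int := (M.+1)./2%:Z; have hE : M.+1%:Z = 2 * h by rewrite /h; lia.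
have nat_case (n : nat) (j : int) : x (2 * j + n%:Z * M.+1%:Z) = x (2 * j) + n%:R.
  elim: n => [|n IHn]; first by rewrite mul0r !addr0.
  have -> : 2 * j + n.+1%:Z * M.+1%:Z = 2 * (j + n%:Z * h) + M.+1%:Z.
    by rewrite hE -[n.+1]addn1 PoszD; ring.
  rewrite st -(natr1 n) addrA -IHn; congr (x _ + 1); rewrite hE; ring.
case: q => n; first exact: nat_case.
have := nat_case n.+1 (i + Negz n * h).
have -> : 2 * (i + Negz n * h) = 2 * i + Negz n * M.+1%:Z by rewrite hE; ring.
have -> : 2 * i + Negz n * M.+1%:Z + n.+1%:Z * M.+1%:Z = 2 * i.
  by rewrite NegzE; ring.
by move=> ->; rewrite NegzE mulrNz addrK.
Qed.

Lemma lifts_even_zero (x : full_shift k) (i : int) : odd M ->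
  lifts M x toeplitz_point -> (forall j : int, 0 <= j < M.+1%:Z -> x j = 0) ->
  x (2 * i) = (2 * i %/ M.+1%:Z)%Z%:~R.
Proof.
move=> oM xy x0; pose h : int := (M.+1)./2%:Z.
have hE : M.+1%:Z = 2 * h by rewrite /h; lia.
set q := (2 * i %/ M.+1%:Z)%Z.
have r : 0 <= (2 * i %% M.+1%:Z)%Z < M.+1%:Z by rewrite modz_ge0 // ltz_pmod.
have e : 2 * i = 2 * (i - q * h) + q * M.+1%:Z by rewrite hE; ring.
rewrite {1}e lifts_even // x0 ?add0r //.
have -> : 2 * (i - q * h) = (2 * i %% M.+1%:Z)%Z by rewrite /modz -/q hE; ring.
exact: r.
Qed.

Lemma even_double_neq1 (v : 'Z_k) : ~~ odd k -> v + v <> 1.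
Proof.
move=> ek /(congr1 val) /=; move: (nat_of_ord v) => n.
rewrite Zp_cast // => /(congr1 odd).
by rewrite odd_mod ?(negbTE ek) // oddD addbb ?modn_small.
Qed.

(** For even [k] and [M.+1 = 2] the letters at the positions [4 m] keep the
    parity of the letter at 0. *)
Lemma not_minimal_two_even : M = 1%N -> ~~ odd k -> ~ minimal X.
Proof.
move=> M1 ek min.
have oM : odd M by rewrite M1.
have [x xy x0] := lifts_exists M toeplitz_point (fun=> 0 : 'Z_k).
have [x' xy' x'0] := lifts_exists M toeplitz_point (fun=> 1 : 'Z_k).
have [m hm] := toeplitz_point_match min xy xy'.
have := hm 0 isT; rewrite x'0 // add0r.
have -> : 4 * m = 2 * (2 * m) by ring.
rewrite lifts_even_zero // M1.
have -> : (2 * (2 * m) %/ 2%:Z)%Z = m + m by lia.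
by rewrite intrD => /even_double_neq1; apply.
Qed.

(** For [M.+1 = 4] the letters at the positions [4 m] and [4 m + 2] keep their
    difference. *)
Lemma not_minimal_four : M = 3%N -> ~ minimal X.
Proof.
move=> M3 min.
have oM : odd M by rewrite M3.
have [x xy x0] := lifts_exists M toeplitz_point (fun=> 0 : 'Z_k).
have [x' xy' x'0] := lifts_exists M toeplitz_point
  (fun i => if i == 2 then 1 else 0 : 'Z_k).
have [m hm] := toeplitz_point_match min xy xy'.
have e0 := hm 0 isT; have e2 := hm 2 isT.
rewrite !x'0 ?M3 //= in e0 e2.
have ea : 0 + 4 * m = 2 * (2 * m) by ring.
have eb : 2 + 4 * m = 2 * (2 * m + 1) by ring.
rewrite ea lifts_even_zero // M3 in e0.
rewrite eb lifts_even_zero // M3 in e2.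
have ec : (2 * (2 * m + 1) %/ 4%:Z)%Z = (2 * (2 * m) %/ 4%:Z)%Z by lia.
by move/eqP: e2; rewrite ec e0 eq_sym oner_eq0.
Qed.

(** For even [M.+1 >= 6] the lift of an initial window of zeros increases
    at most once along three consecutive even positions, so the pattern 0, 1, 0 never
    appears there. *)
Lemma not_minimal_six : odd M -> (5 <= M)%N -> ~ minimal X.
Proof.
move=> oM M5 min.
have [x xy x0] := lifts_exists M toeplitz_point (fun=> 0 : 'Z_k).
have [x' xy' x'0] := lifts_exists M toeplitz_point
  (fun i => if i == 2 then 1 else 0 : 'Z_k).
have [m hm] := toeplitz_point_match min xy xy'.
pose q (i : int) := (2 * i %/ M.+1%:Z)%Z.
have val (i : int) : 0 <= i <= 2 ->
    (q (2 * m + i))%:~R = (if i == 1 then 1 else 0) :> 'Z_k.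
  move=> hi; rewrite -(lifts_even_zero _ oM xy x0).
  have -> : 2 * (2 * m + i) = 2 * i + 4 * m by ring.
  rewrite hm; last by lia.
  rewrite x'0; last by lia.
  by congr (if _ then _ else _); lia.
have v0 := val 0 isT; have v1 := val 1 isT; have v2 := val 2 isT.
have le01 : q (2 * m + 0) <= q (2 * m + 1) by apply: lez_pdiv2r => //; lia.
have le12 : q (2 * m + 1) <= q (2 * m + 2) by apply: lez_pdiv2r => //; lia.
have le02 : q (2 * m + 2) <= q (2 * m + 0) + 1.
  rewrite -ltzD1 ltz_divLR //.
  have := ltz_ceil (2 * (2 * m + 0)) (isT : 0 < M.+1%:Z).
  by rewrite -/(q _) [X in _ -> _ < X]mulrDl; lia.
have [e|e] : q (2 * m + 1) = q (2 * m + 0) \/ q (2 * m + 2) = q (2 * m + 1) by lia.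
  by move/eqP: v1; rewrite e v0 eq_sym oner_eq0.
by move/eqP: v1; rewrite -e v2 eq_sym oner_eq0.
Qed.

End Strict.

Theorem theorem1p7 (R : realType) (k l : nat) (hk : (2 <= k)%N)
    (hl : (2 <= l)%N) :
  let X : set (full_shift k) := eta_code k l @^-1` X_pd k in
  [/\ ~~ odd l -> strictly_ergodic R X,
      l = 3%N /\ odd k -> strictly_ergodic R X &
      ~ (~~ odd l \/ l = 3%N /\ odd k) -> ~ minimal X].
Proof.
move: hl; case: l => [|[|M]] // _ X.
have ergodic : (forall n, (1 <= n)%N -> mixing k M n) -> strictly_ergodic R X.
  move=> mix; split; first exact: extension_minimal mix.
  exact: extension_uniquely_ergodic mix.
split.
- by move=> eM; apply: ergodic => n _; apply: mixing_odd; rewrite /= negbK in eM *.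
- by move=> [[M1] ok]; apply: ergodic => n n1; rewrite M1; apply: mixing_two.
- move=> h; have oM : odd M
    by rewrite -[odd M]negbK; apply/negP => eM; apply: h; left; rewrite /= negbK.
  have [M1|M1] := eqVneq M 1%N.
    by apply: not_minimal_two_even => //; apply/negP => ok; apply: h; right; rewrite M1.
  have [M3|M3] := eqVneq M 3%N; first exact: not_minimal_four.
  by apply: not_minimal_six => //; case: M oM M1 M3 {X h ergodic} => [|[|[|[|[|M]]]]].
Qed.
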